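(* There exist a truncated convolution operator $T$ and a function $f\in C_0[0,1]$ such that $$\liminf_{n\to\infty}\|T^nf\|_\infty=0\quad\text{and}\quad \limsup_{n\to\infty}\|T^nf\|_1=\infty.$$ In particular, $f$ is an irregular vector for $T$ acting on $L^p[0,1]$ for each $p\in[1,\infty]$.
   Context: $\mathbb{K}$ is either $\mathbb{R}$ or $\mathbb{C}$ and all spaces are over $\mathbb{K}$. $\|\cdot\|_p$ is the norm of $L^p[0,1]$. $C_0[0,1]$ is the Banach space of continuous functions $f:[0,1]\to\mathbb{K}$ with $f(0)=0$, with the sup-norm. $\mathbf{M}$ is the space of finite $\sigma$-additive $\mathbb{K}$-valued Borel measures on $[0,1)$. For $\mu\in\mathbf{M}$, the operator $C_\mu$ on $C_0[0,1]$ is defined by $C_\mu f(x)=\int f_x(t)\,d\mu(t)$, where $f_x(t)=f(x-t)$ if $t\le x$ and $f_x(t)=0$ if $t>x$. Since $\|C_\mu f\|_p\le\|\mu\|\,\|f\|_p$, $C_\mu$ extends uniquely to a bounded linear operator on $L^p[0,1]$ for $1\le p<\infty$, and it acts on $L^\infty[0,1]$ as the restriction of its extension to $L^1[0,1]$. The operators $C_\mu$, $\mu\in\mathbf{M}$, are called truncated convolution operators. For a Banach space $X$ and a bounded linear operator $T$ on $X$, a vector $x\in X$ is irregular for $T$ if $\liminf_{n\to\infty}\|T^nx\|=0$ and $\limsup_{n\to\infty}\|T^nx\|=\infty$. *)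

(* Defs.v *)
(* Library: MathComp / MathComp-Analysis, with real-closed for R[i]. *)
From HB Require Import structures.
From mathcomp Require Import all_boot all_order all_algebra.
From mathcomp Require Import all_classical all_reals all_analysis.
From mathcomp Require Import complex.

Set Implicit Arguments.
Unset Strict Implicit.
Unset Printing Implicit Defensive.

Import Order.TTheory GRing.Theory Num.Theory.
Import numFieldNormedType.Exports.

Local Open Scope classical_set_scope.
Local Open Scope ring_scope.

Variant scalar_kind := RealScalars | ComplexScalars.

Definition scalar_field (R : realType) (k : scalar_kind) : numFieldType :=
  match k with
  | RealScalars => R
  | ComplexScalars => R[i]
  end.

(* The norm of [R[i]] takes its values in [R[i]]; here the modulus is a real. *)
Definition modulus (R : realType) (k : scalar_kind) : scalar_field R k -> R :=
  match k with
  | RealScalars => fun z => `|z|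
  | ComplexScalars => fun z => Num.sqrt (complex.Re z ^+ 2 + complex.Im z ^+ 2)
  end.

(* The integral over [D] with respect to a signed measure; it does not depend
   on the Hahn decomposition that is picked. *)
Definition charge_integral (R : realType)
    (nu : {charge set (measurableTypeR R) -> \bar R})
    (D : set R) (g : R -> R) : R :=
  let H := cid (Hahn_decomposition nu) in
  let nuPN := svalP (cid (svalP H)) in
  Rintegral (jordan_pos nuPN) D g - Rintegral (jordan_neg nuPN) D g.

(* Finite sigma-additive scalar-valued measures on the Borel sets of the line:
   signed measures, resp. pairs (real part, imaginary part) of signed
   measures. *)
Definition kmeasure (R : realType) (k : scalar_kind) : Type :=
  match k with
  | RealScalars => {charge set (measurableTypeR R) -> \bar R}
  | ComplexScalars => ({charge set (measurableTypeR R) -> \bar R} *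
                       {charge set (measurableTypeR R) -> \bar R})%type
  end.

(* Borel measures on [0, 1) are identified with the Borel measures on the line
   vanishing on the Borel sets disjoint from [0, 1). *)
Definition carried_01 (R : realType)
    (nu : {charge set (measurableTypeR R) -> \bar R}) : Prop :=
  forall A : set (measurableTypeR R), measurable A ->
    A `&` `[0, 1[%classic = set0 -> nu A = 0%E.

Definition measure_01 (R : realType) (k : scalar_kind) :
    kmeasure R k -> Prop :=
  match k with
  | RealScalars => fun mu => carried_01 mu
  | ComplexScalars => fun mu => carried_01 mu.1 /\ carried_01 mu.2
  end.

Definition kintegral (R : realType) (k : scalar_kind) :
    kmeasure R k -> set R -> (R -> scalar_field R k) -> scalar_field R k :=
  match k with
  | RealScalars => fun mu D g => charge_integral mu D g
  | ComplexScalars => fun mu D g =>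
      let re x := complex.Re (g x) in
      let im x := complex.Im (g x) in
      Complex (charge_integral mu.1 D re - charge_integral mu.2 D im)
              (charge_integral mu.1 D im + charge_integral mu.2 D re)
  end.

(* Functions on [0, 1] are represented by functions on the line, whose values
   outside of [0, 1] are never used. *)
Definition C0_01 (R : realType) (k : scalar_kind) (f : R -> scalar_field R k) : Prop :=
  {within `[0, 1], continuous f} /\ f 0 = 0.

Definition truncated_convolution (R : realType) (k : scalar_kind)
    (mu : kmeasure R k) (f : R -> scalar_field R k) : R -> scalar_field R k :=
  fun x => kintegral mu `[0, 1[%classic
             (fun t => if t <= x then f (x - t) else 0).

Definition kmeasurable_01 (R : realType) (k : scalar_kind) :
    (R -> scalar_field R k) -> Prop :=
  match k with
  | RealScalars => fun g =>
      measurable_fun (`[0, 1]%classic : set (measurableTypeR R))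
        (g : measurableTypeR R -> measurableTypeR R)
  | ComplexScalars => fun g =>
      measurable_fun (`[0, 1]%classic : set (measurableTypeR R))
        ((fun x => complex.Re (g x)) : measurableTypeR R -> measurableTypeR R) /\
      measurable_fun (`[0, 1]%classic : set (measurableTypeR R))
        ((fun x => complex.Im (g x)) : measurableTypeR R -> measurableTypeR R)
  end.

(* The norm of L^p[0,1]: the norm over the line of the extension by zero. *)
Definition Lp_norm (R : realType) (k : scalar_kind) (p : \bar R)
    (g : R -> scalar_field R k) : \bar R :=
  Lnorm (@lebesgue_measure R) p
    (EFin \o ((fun x => modulus (g x)) \_ `[0, 1]%classic)).

(* L^p[0,1] is handled through representatives: its elements are functions
   satisfying [in_Lp], and equality is [ae_eq_01]. *)
Definition in_Lp (R : realType) (k : scalar_kind) (p : \bar R)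
    (g : R -> scalar_field R k) : Prop :=
  kmeasurable_01 g /\ (Lp_norm p g < +oo)%E.

Definition ae_eq_01 (R : realType) (k : scalar_kind)
    (g h : R -> scalar_field R k) : Prop :=
  {ae (@lebesgue_measure R), forall x, `[0, 1]%classic x -> g x = h x}.

(* [bound] and [linear] imply that [T] respects [ae_eq_01] on L^p, i.e. that it
   is an operator on the quotient. *)
Record bounded_operator (R : realType) (k : scalar_kind) (p : \bar R)
    (T : (R -> scalar_field R k) -> (R -> scalar_field R k)) : Prop := BoundedOperator {
  bounded_operator_stable : forall g, in_Lp p g -> in_Lp p (T g) ;
  bounded_operator_linear : forall (a : scalar_field R k) g h,
    in_Lp p g -> in_Lp p h ->
    ae_eq_01 (T (fun x => a * g x + h x)) (fun x => a * T g x + T h x) ;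
  bounded_operator_bound : exists M : R, forall g, in_Lp p g ->
    (Lp_norm p (T g) <= M%:E * Lp_norm p g)%E }.

Definition extends_convolution (R : realType) (k : scalar_kind)
    (mu : kmeasure R k) (T : (R -> scalar_field R k) -> (R -> scalar_field R k)) : Prop :=
  forall g, C0_01 g -> ae_eq_01 (T g) (truncated_convolution mu g).

(* [T] is the truncated convolution operator of [mu] acting on L^p[0,1]. *)
Definition convolution_on_Lp (R : realType) (k : scalar_kind)
    (mu : kmeasure R k) (p : \bar R)
    (T : (R -> scalar_field R k) -> (R -> scalar_field R k)) : Prop :=
  bounded_operator p T /\
  if p == +oo%E then
    exists T1, [/\ bounded_operator 1%E T1, extends_convolution mu T1 &
                   forall g, in_Lp +oo%E g -> ae_eq_01 (T g) (T1 g)]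
  else extends_convolution mu T.

Definition irregular_Lp (R : realType) (k : scalar_kind) (p : \bar R)
    (T : (R -> scalar_field R k) -> (R -> scalar_field R k)) (f : R -> scalar_field R k) : Prop :=
  [/\ in_Lp p f,
      limn_einf (fun n => Lp_norm p (iter n T f)) = 0%E &
      limn_esup (fun n => Lp_norm p (iter n T f)) = +oo%E].

(* Main.v *)
(* The measure is mu = d_0 + d_(1/2) - Lebesgue, so that T = (I - V) + S with V the
   Volterra operator and S the shift by 1/2, which commutes with V and satisfies
   S^2 = 0; hence T^n = (I - V)^n + n S (I - V)^(n-1).
   - Decay.  The energy V(e^-t u^2) is nonincreasing along u -> (I - V)u, with
     defect e^-x (Vu)^2, so (I - V)^n V is bounded pointwise in n.  With M the
     multiplication by x, [M, (I - V)^n] = - n (I - V)^(n-1) V^2, so each further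
     factor V^2 gains 1/n, and T^n V^5 h = O(1/n).
   - Growth.  For f = ramp(x) cos(yx) in the range of V^5 and y large with respect
     to m, Vf is so small that (I - V)^m f is close to f, and T^m f is close to
     f + m S f, whose L^1 norm is at least c m with c independent of y.
   - A gliding hump combining both gives f; it is real-valued, and serves for
     real and complex scalars.
   On L^p, T is given by the same formula as on C_0, and its powers at f are
   determined almost everywhere by those of the convolution. *)
Require Import Defs.
From mathcomp Require Import all_boot all_order all_algebra.
From mathcomp Require Import all_classical all_reals all_analysis.
From mathcomp Require Import measurable_realfun ess_sup_inf complex ring lra zify.

Set Implicit Arguments.
Unset Strict Implicit.
Unset Printing Implicit Defensive.

Import Order.TTheory GRing.Theory Num.Theory.
Import numFieldNormedType.Exports.

Local Open Scope classical_set_scope.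
Local Open Scope ring_scope.


(** * The Volterra operator *)

Section Volterra.
Variable R : realType.
Implicit Types (f g h F : R -> R) (a c x y : R).

(** In T^n the coefficient n multiplies S (I - V)^(n-1), so T^n f = O(1/n) asks for (I - V)^n f =
    O(1/n^2), that is for two gains of 1/n: V^5 is the V of the energy bound times two factors V^2.
    Each gain needs bounds for g and for x g, which are at hand because the range of V^j is stable
    under multiplication by x. Decay and growth do not conflict: the decay constant of an
    oscillating ramp depends on its frequency y, and y is chosen after the time m at which the orbit
    has to be large. T is a sum of three contractions for the sup norm, so T^n amplifies by at most
    3^n. A hump of size 9^-N therefore changes the orbit up to time N by at most 3^-N. Functions
    live on the whole line and vanish left of 0, which makes S a plain translation and V f
    differentiable at 0; identities for V then follow from uniqueness of primitives. *)

Definition volterra f x := \int[@lebesgue_measure R]_(t in `[0, x]) f t.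

(* The continuous functions on [0, 1] vanishing at 0, extended by 0 to the left of 0
   and in some continuous way to the right of 1. *)
Definition causal f := continuous f /\ forall x, x <= 0 -> f x = 0.

Lemma continuous_integrable_itv f a b : continuous f ->
  (@lebesgue_measure R).-integrable `[a, b] (EFin \o f).
Proof.
move=> cf; apply: continuous_compact_integrable; first exact: segment_compact.
exact: continuous_subspaceT.
Qed.

Lemma volterra_le0 f x : x <= 0 -> volterra f x = 0.
Proof.
rewrite le_eqVlt => /predU1P[->|x0].
  by rewrite /volterra set_itv1 Rintegral_set1.
by rewrite /volterra set_itv_ge ?Rintegral_set0// -leNgt bnd_simp.
Qed.

Lemma is_derive_volterra f x : causal f -> is_derive x 1 (volterra f) (f x).
Proof.
move=> [cf f0]; have [x0|x0] := ltP x 0.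
  rewrite f0 ?(ltW x0)//.
  apply: (@near_eq_is_derive _ _ _ (cst 0) (volterra f)).
    near=> y; rewrite volterra_le0//.
    by apply: ltW; near: y; exact: lt_nbhsl.

(* The fundamental theorem is applied on an interval with x in its interior; starting at -1 makes 0
   interior too, and costs nothing since f vanishes on [-1, 0]. *)
pose G y := \int[@lebesgue_measure R]_(t in `[-1, y]) f t.
have [dG G'] : derivable G x 1 /\ derive1 G x = f x.
  apply: (@continuous_FTC1_closed _ f (-1) x (x + 1)); rewrite ?ltrDl//.
    exact: continuous_integrable_itv.
    by rewrite (lt_le_trans _ x0)// ltrN10.
    exact: cf.
have GV : {near x, G =1 volterra f}.
  near=> y.
  have y1 : -1 < y.
    by near: y; apply: lt_nbhsr; rewrite (lt_le_trans _ x0)// ltrN10.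
  have [y0|y0] := leP y 0.
    rewrite volterra_le0// /G.
    rewrite (@eq_Rintegral _ _ _ _ _ (cst 0)).
      by rewrite Rintegral_cst//= mul0r.
    move=> t /set_mem/=; rewrite in_itv/= => /andP[_ ty].
    by rewrite f0// (le_trans ty).
  rewrite /G /volterra.
  rewrite (@itv_bndbnd_setU _ _ _ (BLeft 0)) ?bnd_simp ?lerN10 ?(ltW y0)//.
  rewrite Rintegral_setU//=.
  - rewrite (@eq_Rintegral _ _ _ _ _ (cst 0)).
      by rewrite Rintegral_cst//= mul0r add0r.
    move=> t /set_mem/=; rewrite in_itv/= => /andP[_ ty].
    by rewrite f0// ltW.
  - rewrite -itv_bndbnd_setU ?bnd_simp ?lerN10 ?(ltW y0)//.
    exact: continuous_integrable_itv.
  - apply/disj_setPS => t/= [] /=; rewrite !in_itv/= => /andP[_ ?] /andP[+ _].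
    by rewrite leNgt => /negP.
apply: near_eq_is_derive GV _.
by apply: DeriveDef => //; rewrite -derive1E.
Unshelve. all: end_near. Qed.

Lemma causal_volterra f : causal f -> causal (volterra f).
Proof.
move=> cf; split; last by move=> x; exact: volterra_le0.
move=> x; apply: differentiable_continuous; apply/derivable1_diffP.
by case: (is_derive_volterra x cf).
Qed.

(** Used for all algebraic identities of V below: both sides are compared through their
    derivatives. *)
Lemma volterra_unique F f : causal f ->
  (forall x, is_derive x 1 F (f x)) -> F 0 = 0 -> F = volterra f.
Proof.
move=> cf dF F0; apply/funext => x; apply/eqP; rewrite -subr_eq0; apply/eqP.
have d0 : forall x, is_derive x 1 (F - volterra f) 0.
  move=> y; have d1 := dF y; have d2 := is_derive_volterra y cf.
  by rewrite -(subrr (f y)); exact: is_deriveB.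
have := is_derive_0_is_cst x 0 d0.
  move=> E; rewrite -[LHS]/((F - volterra f) x) E.
by change (F 0 - volterra f 0 = 0); rewrite F0 volterra_le0 ?subr0.
Qed.

Lemma volterra_ge0 f x : (forall t, 0 <= f t) -> 0 <= volterra f x.
Proof. by move=> f0; exact: Rintegral_ge0. Qed.

Lemma volterra_le_cst f c x : continuous f -> 0 <= x ->
  (forall t, 0 <= t <= x -> f t <= c) -> volterra f x <= c * x.
Proof.
move=> cf x0 fc.
apply: (@le_trans _ _ (\int[@lebesgue_measure R]_(t in `[0, x]) c)).
  apply: le_Rintegral => //.
  - exact: continuous_integrable_itv.
  - by apply: continuous_integrable_itv => ?; exact: cvg_cst.
rewrite Rintegral_cst//= lebesgue_measure_itv/= lte_fin.
case: ltP => [_|x0']; first by rewrite sube0.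
by rewrite (@le_anti _ _ x 0)// x0 x0'.
Qed.

Lemma le_volterra f g x : continuous f -> continuous g ->
  (forall t, 0 <= t <= x -> f t <= g t) -> volterra f x <= volterra g x.
Proof. by move=> cf cg fg; apply: le_Rintegral => //; exact: continuous_integrable_itv. Qed.

End Volterra.


(** * Decay of the powers of I - V *)

Section Decay.
Variable R : realType.
Implicit Types (f g h F u : R -> R) (a c x y : R).

Lemma is_derive1D f g x a c : is_derive x 1 f a -> is_derive x 1 g c ->
  is_derive x 1 (fun t => f t + g t) (a + c).
Proof. exact: is_deriveD. Qed.

Lemma is_derive1B f g x a c : is_derive x 1 f a -> is_derive x 1 g c ->
  is_derive x 1 (fun t => f t - g t) (a - c).
Proof. exact: is_deriveB. Qed.

Lemma is_derive1M f g x a c : is_derive x 1 f a -> is_derive x 1 g c ->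
  is_derive x 1 (fun t => f t * g t) (a * g x + f x * c).
Proof.
move=> df dg; have := is_deriveM df dg.
by rewrite /GRing.scale/= addrC [g x * a]mulrC.
Qed.

Lemma is_derive1Z f x b a : is_derive x 1 f a ->
  is_derive x 1 (fun t => b * f t) (b * a).
Proof. exact: is_deriveZ. Qed.

Lemma is_derive1_shift f x b a : is_derive (x - b) 1 f a ->
  is_derive x 1 (fun t => f (t - b)) a.
Proof.
move=> df.
have dl : is_derive x (1:R) (fun t : R => t - b) (1 - 0).
  exact: is_derive1B.
have := @is_derive1_comp _ f (fun t => t - b) x _ _ df dl.
by rewrite subr0 mulr1.
Qed.

Lemma causalD f g : causal f -> causal g -> causal (fun x => f x + g x).
Proof.
move=> [cf f0] [cg g0]; split.
  by move=> x; apply: cvgD; [exact: cf|exact: cg].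
by move=> x x0; rewrite f0// g0// addr0.
Qed.

Lemma causalM g f : continuous g -> causal f -> causal (fun x => g x * f x).
Proof.
move=> cg [cf f0]; split.
  by move=> x; apply: cvgM; [exact: cg|exact: cf].
by move=> x x0; rewrite f0// mulr0.
Qed.

Lemma causalZ a f : causal f -> causal (fun x => a * f x).
Proof. by apply: causalM => x; exact: cvg_cst. Qed.

Lemma causal_mul_id f : causal f -> causal (fun x => x * f x).
Proof. by apply: causalM => x; exact: cvg_id. Qed.

Lemma causalB f g : causal f -> causal g -> causal (fun x => f x - g x).
Proof.
move=> [cf f0] [cg g0]; split.
  by move=> x; apply: cvgB; [exact: cf|exact: cg].
by move=> x x0; rewrite f0// g0// subr0.
Qed.

Lemma causal_norm f : causal f -> causal (fun x => `|f x|).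
Proof.
move=> [cf f0]; split; last by move=> x x0; rewrite f0// normr0.
by move=> x; apply: cvg_norm; exact: cf.
Qed.

Lemma causal_shift b f : 0 <= b -> causal f -> causal (fun x => f (x - b)).
Proof.
move=> b0 [cf f0]; split; last first.
  by move=> x x0; rewrite f0// subr_le0 (le_trans x0).
move=> x; apply: (@continuous_comp _ _ _ (fun t => t - b) f); last exact: cf.
by apply: cvgB; [exact: cvg_id|exact: cvg_cst].
Qed.

Lemma volterraD f g : causal f -> causal g ->
  volterra (fun x => f x + g x) = fun x => volterra f x + volterra g x.
Proof.
move=> cf cg; apply/esym/volterra_unique; first exact: causalD.
  by move=> x; apply: is_derive1D; exact: is_derive_volterra.
by rewrite !volterra_le0// addr0.
Qed.

Lemma volterraB f g : causal f -> causal g ->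
  volterra (fun x => f x - g x) = fun x => volterra f x - volterra g x.
Proof.
move=> cf cg; apply/esym/volterra_unique; first exact: causalB.
  by move=> x; apply: is_derive1B; exact: is_derive_volterra.
by rewrite !volterra_le0// subr0.
Qed.

Lemma volterraZ a f : causal f ->
  volterra (fun x => a * f x) = fun x => a * volterra f x.
Proof.
move=> cf; apply/esym/volterra_unique; first exact: causalZ.
  by move=> x; apply: is_derive1Z; exact: is_derive_volterra.
by rewrite !volterra_le0// mulr0.
Qed.

Lemma volterra_shift b f : 0 <= b -> causal f ->
  volterra (fun x => f (x - b)) = fun x => volterra f (x - b).
Proof.
move=> b0 cf; apply/esym/volterra_unique; first exact: causal_shift.
  by move=> x; apply: is_derive1_shift; exact: is_derive_volterra.
by rewrite volterra_le0// sub0r oppr_le0.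
Qed.

(** The product rule for x V f; with M the multiplication by x it reads [M, V] = V^2, the source of
    the later commutators. *)
Lemma volterra_mul_id f : causal f ->
  (fun x => x * volterra f x) =
  volterra (fun x => x * f x + volterra f x).
Proof.
move=> cf; apply: volterra_unique.
- by apply: causalD; [exact: causal_mul_id|exact: causal_volterra].
- move=> x; rewrite addrC -[X in X + _]mul1r.
  by apply: is_derive1M; exact: is_derive_volterra.
- by rewrite mul0r.
Qed.

Lemma continuous_bounded01 f : continuous f ->
  exists C, forall x, 0 <= x <= 1 -> `|f x| <= C.
Proof.
move=> cf; have cf' : {within `[0, 1], continuous (fun x : R => `|f x|)}.
  by apply: continuous_subspaceT => x; apply: cvg_norm; exact: cf.
have [c _ cP] := EVT_max ler01 cf'.
by exists `|f c| => x x01; apply: cP; rewrite in_itv.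
Qed.

Definition idVolterra f x := f x - volterra f x.

Lemma causal_idVolterra f : causal f -> causal (idVolterra f).
Proof. by move=> cf; apply: causalB => //; exact: causal_volterra. Qed.

Lemma causal_iter_idVolterra n f : causal f -> causal (iter n idVolterra f).
Proof. by move=> cf; elim: n => //= n; exact: causal_idVolterra. Qed.

Lemma idVolterraD f g : causal f -> causal g ->
  idVolterra (fun x => f x + g x) = fun x => idVolterra f x + idVolterra g x.
Proof.
by move=> cf cg; apply/funext => x; rewrite /idVolterra volterraD//; lra.
Qed.

Lemma idVolterraZ a f : causal f ->
  idVolterra (fun x => a * f x) = fun x => a * idVolterra f x.
Proof.
by move=> cf; apply/funext => x; rewrite /idVolterra volterraZ//; lra.
Qed.

Lemma idVolterra_shift b f : 0 <= b -> causal f ->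
  idVolterra (fun x => f (x - b)) = fun x => idVolterra f (x - b).
Proof.
by move=> b0 cf; apply/funext => x; rewrite /idVolterra volterra_shift.
Qed.

Lemma idVolterra_volterra f : causal f ->
  idVolterra (volterra f) = volterra (idVolterra f).
Proof.
by move=> cf; rewrite [in RHS]/idVolterra volterraB//; exact: causal_volterra.
Qed.

Lemma iter_idVolterra_volterra n f : causal f ->
  iter n idVolterra (volterra f) = volterra (iter n idVolterra f).
Proof.
move=> cf; elim: n => //= n ->.
by rewrite idVolterra_volterra//; exact: causal_iter_idVolterra.
Qed.

(** With F = V u, the weight e^-x is the integrating factor that turns u^2 - (u - F)^2 = 2 F F' -
    F^2 into a total derivative. *)
Let energy u x := expR (- x) * u x ^+ 2.

Let causal_energy u : causal u -> causal (energy u).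
Proof.
move=> [cu u0]; split.
  move=> x; apply: cvgM; last by rewrite expr2; apply: cvgM; exact: cu.
  apply: continuous_comp; last exact: continuous_expR.
  by apply: cvgN; exact: cvg_id.
by move=> x x0; rewrite /energy u0// expr0n mulr0.
Qed.

(* With F := volterra u, this is (e^-x F^2)' = e^-x (u^2 - (u - F)^2). *)
Lemma volterra_energy u x : causal u ->
  volterra (energy u) x =
  volterra (energy (idVolterra u)) x + expR (- x) * volterra u x ^+ 2.
Proof.
move=> cu; suff -> : volterra (energy u) = (fun x =>
  volterra (energy (idVolterra u)) x + expR (- x) * volterra u x ^+ 2) by [].
apply/esym/volterra_unique; first exact: causal_energy.
- move=> {}x; have dF := is_derive_volterra x cu.
  have dE : is_derive x 1 (fun t : R => expR (- t)) (- expR (- x)).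
    have := @is_derive1_comp _ expR -%R x _ _ (is_derive_expR _) (is_deriveNid _ _).
    by rewrite mulrN1.
  have dW := is_derive_volterra x (causal_energy (causal_idVolterra cu)).
  have := is_derive1D dW (is_derive1M dE (is_derive1M dF dF)).
  suff E : energy u x = energy (idVolterra u) x +
      (- expR (- x) * (volterra u x * volterra u x) +
       expR (- x) * (u x * volterra u x + volterra u x * u x)) by rewrite E.
  by rewrite /energy /idVolterra; ring.
- by rewrite !volterra_le0// expr0n mulr0 addr0.
Qed.

Lemma iter_idVolterra_bounded u : causal u -> exists C, forall n x,
  0 <= x <= 1 -> `|iter n idVolterra (volterra u) x| <= C.
Proof.
move=> cu.
have ge0_energy v t : 0 <= energy v t by rewrite mulr_ge0 ?expR_ge0 ?sqr_ge0.
have le_energy n x : volterra (energy (iter n idVolterra u)) x <=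
    volterra (energy u) x.
  elim: n => //= n; apply: le_trans.
  rewrite [leRHS]volterra_energy ?lerDl; last exact: causal_iter_idVolterra.
  by rewrite mulr_ge0 ?expR_ge0 ?sqr_ge0.
have cV : continuous (fun x => expR x * volterra (energy u) x).
  move=> x; apply: cvgM; first exact: continuous_expR.
  by have /causal_volterra[+ _] := causal_energy cu; apply.
have [C CP] := continuous_bounded01 cV.
exists (C + 1) => n x x01; rewrite iter_idVolterra_volterra//.
have cn := causal_iter_idVolterra n cu.
have : volterra (iter n idVolterra u) x ^+ 2 <= C.
  apply: le_trans (CP x x01); apply: le_trans (ler_norm _).
  rewrite -ler_pdivrMl ?expR_gt0// -expRN (le_trans _ (le_energy n x))//.
  (* Only the defect of the n-th step is kept; the energy of the next iterate is nonnegative. *)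
  rewrite volterra_energy// lerDr; apply: volterra_ge0 => t.
  exact: ge0_energy.
(* A square root is avoided: 2 |v| <= v^2 + 1 <= C + 1. *)
set v := volterra _ _ => vC; have := sqr_ge0 (`|v| - 1).
by rewrite -real_normK ?num_real// in vC; have := normr_ge0 v; nra.
Qed.

(* The commutator of the multiplication by x with p(V) is p'(V) V^2; here
   p(V) = (I - V)^n. *)
Lemma iter_idVolterra_mul_id n g : causal g ->
  iter n idVolterra (fun x => x * g x) = fun x => x * iter n idVolterra g x +
    n%:R * iter n.-1 idVolterra (volterra (volterra g)) x.
Proof.
move=> cg; elim: n => [|n IH]; first by apply/funext => x/=; rewrite mul0r addr0.
rewrite iterS IH.
have cgn := causal_iter_idVolterra n cg.
have cV : causal (volterra (volterra g)) by do 2 apply: causal_volterra.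
rewrite idVolterraD; last 2 first.
- exact: causal_mul_id.
- by apply: causalZ; exact: causal_iter_idVolterra.
rewrite idVolterraZ; last exact: causal_iter_idVolterra.
apply/funext => x.
(* For n = 0 the truncated predecessor makes the iterates differ by one step; the coefficient 0
   hides this. *)
have -> : n%:R * idVolterra (iter n.-1 idVolterra (volterra (volterra g))) x =
    n%:R * iter n idVolterra (volterra (volterra g)) x.
  by case: (n) => [|m]; rewrite ?mul0r.
rewrite [n.+1.-1]/= iterS /idVolterra -/idVolterra.
have := congr1 (@^~ x) (volterra_mul_id cgn).
rewrite volterraD; last 2 first.
- exact: causal_mul_id.
- exact: causal_volterra.
rewrite !iter_idVolterra_volterra//; last exact: causal_volterra.
by rewrite -natr1/= => E; lra.
Qed.

Definition decay q f := exists C, forall n x, 0 <= x <= 1 ->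
  n.+1%:R ^+ q * `|iter n idVolterra f x| <= C.

Lemma decay0_volterra h : causal h -> decay 0 (volterra h).
Proof.
move=> ch; have [C CP] := iter_idVolterra_bounded ch.
by exists C => n x x01; rewrite expr0 mul1r; exact: CP.
Qed.

(** Solved for its last term, the commutator identity at n + 1 expresses (n + 1) (I - V)^n V^2 g
    through (I - V)^(n+1) applied to g and to x g; hence the hypothesis on x g. *)
Lemma decayS q g : causal g -> decay q g -> decay q (fun x => x * g x) ->
  decay q.+1 (volterra (volterra g)).
Proof.
move=> cg [C CP] [D DP]; exists (C + D) => n x x01.
have /andP[x0 x1] := x01.
have := congr1 (@^~ x) (iter_idVolterra_mul_id n.+1 cg).
move=> /(congr1 (fun z => z - x * iter n.+1 idVolterra g x)).
rewrite [X in _ = X -> _]addrAC subrr add0r succnK => E.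
have {}E : n.+1%:R * `|iter n idVolterra (volterra (volterra g)) x| =
    `|iter n.+1 idVolterra (fun t => t * g t) x - x * iter n.+1 idVolterra g x|.
  by rewrite E normrM (ger0_norm (ler0n _ _)).
rewrite exprSr -mulrA E.
have n12 : n.+1%:R ^+ q <= n.+2%:R ^+ q :> R.
  by rewrite lerXn2r ?nnegrE// ler_nat.
apply: (@le_trans _ _ (n.+2%:R ^+ q * `|iter n.+1 idVolterra (fun t => t * g t) x|
  + n.+2%:R ^+ q * `|iter n.+1 idVolterra g x|)); last first.
  by rewrite addrC; apply: lerD; [exact: CP|exact: DP].
rewrite -mulrDr; apply: ler_pM => //.
apply: (le_trans (ler_normB _ _)); rewrite lerD2l normrM ger0_norm//.
by rewrite ler_piMl.
Qed.

(** Since x V h = V (x h + V h) is again in the range of V, both hypotheses of [decayS] come from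
    the energy bound. *)
Lemma decay1_volterra3 h : causal h -> decay 1 (iter 3 (@volterra R) h).
Proof.
move=> ch; have cV := causal_volterra ch.
apply: decayS => //; first exact: decay0_volterra.
rewrite volterra_mul_id//; apply: decay0_volterra; apply: causalD => //.
exact: causal_mul_id.
Qed.

Lemma causal_iter_volterra n h : causal h -> causal (iter n (@volterra R) h).
Proof. by move=> ch; elim: n => //= n; exact: causal_volterra. Qed.

Lemma iter_volterraD n f g : causal f -> causal g ->
  iter n (@volterra R) (fun x => f x + g x) =
  fun x => iter n (@volterra R) f x + iter n (@volterra R) g x.
Proof.
move=> cf cg; elim: n => //= n ->.
by rewrite volterraD//; exact: causal_iter_volterra.
Qed.

(** This is [M, V^n] = n V^(n+1), by induction from [M, V] = V^2. It keeps the range of V^n stable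
    under multiplication by x, as the second use of [decayS] demands. *)
Lemma iter_volterra_mul_id n h : causal h ->
  (fun x => x * iter n (@volterra R) h x) =
  iter n (@volterra R) (fun x => x * h x + n%:R * volterra h x).
Proof.
move=> ch; elim: n => [|n IH].
  by apply/funext => x; rewrite /= mul0r addr0.
have cV := causal_volterra ch.
have cM : causal (fun x => x * h x + n%:R * volterra h x).
  by apply: causalD; [exact: causal_mul_id|exact: causalZ].
rewrite iterS volterra_mul_id; last exact: causal_iter_volterra.
rewrite iterS; congr volterra.
transitivity (iter n (@volterra R)
    (fun x => (x * h x + n%:R * volterra h x) + volterra h x)).
  rewrite iter_volterraD// -IH; apply/funext => x.
  by rewrite -iterS iterSr.
congr iter; apply/funext => x; rewrite -natr1; ring.
Qed.

Lemma decay2_volterra5 h : causal h -> decay 2 (iter 5 (@volterra R) h).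
Proof.
move=> ch; have cV := causal_volterra ch.
apply: decayS; first exact: (causal_iter_volterra 3).
  exact: decay1_volterra3.
rewrite -[volterra (volterra (volterra h))]/(iter 3 (@volterra R) h).
rewrite iter_volterra_mul_id//; apply: decay1_volterra3.
by apply: causalD; [exact: causal_mul_id|exact: causalZ].
Qed.

End Decay.


(** * The operator T and the test functions *)

Section Growth.
Variable R : realType.
Implicit Types (f g h F u : R -> R) (a c x y : R).
Local Notation V := (@volterra R).

(* The truncated convolution with d_0 + d_(1/2) - Lebesgue, for arguments in [0, 1]. *)
Definition tconv f x :=
  idVolterra f x + (if 2^-1 <= x then f (x - 2^-1) else 0).

Lemma half01 : 0 < 2^-1 :> R. Proof. by rewrite invr_gt0. Qed.

(** For causal f the case distinction is absorbed by f itself. [tconv] keeps it because it is also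
    applied to representatives in L^p, whose values left of 0 are arbitrary. *)
Lemma tconvE f : causal f -> tconv f = fun x => idVolterra f x + f (x - 2^-1).
Proof.
move=> [_ f0]; apply/funext => x; rewrite /tconv; case: leP => // xh.
by rewrite [f (_ - _)]f0// subr_le0 ltW.
Qed.

Lemma causal_shift_half f : causal f -> causal (fun x => f (x - 2^-1)).
Proof. by apply: causal_shift; exact: ltW half01. Qed.

Lemma causal_tconv f : causal f -> causal (tconv f).
Proof.
move=> cf; rewrite tconvE//; apply: causalD; first exact: causal_idVolterra.
exact: causal_shift_half.
Qed.

Lemma causal_iter_tconv n f : causal f -> causal (iter n tconv f).
Proof. by move=> cf; elim: n => //= n; exact: causal_tconv. Qed.

Lemma tconvD f g : causal f -> causal g ->
  tconv (fun x => f x + g x) = fun x => tconv f x + tconv g x.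
Proof.
move=> cf cg; rewrite !tconvE//; last exact: causalD.
by rewrite idVolterraD//; apply/funext => x; ring.
Qed.

Lemma tconvZ a f : causal f -> tconv (fun x => a * f x) = fun x => a * tconv f x.
Proof.
move=> cf; rewrite !tconvE//; last exact: causalZ.
by rewrite idVolterraZ//; apply/funext => x; ring.
Qed.

Lemma iter_tconvD n f g : causal f -> causal g ->
  iter n tconv (fun x => f x + g x) =
  fun x => iter n tconv f x + iter n tconv g x.
Proof.
move=> cf cg; elim: n => //= n ->.
by rewrite tconvD//; exact: causal_iter_tconv.
Qed.

Lemma iter_tconvZ n a f : causal f ->
  iter n tconv (fun x => a * f x) = fun x => a * iter n tconv f x.
Proof.
move=> cf; elim: n => //= n ->.
by rewrite tconvZ//; exact: causal_iter_tconv.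
Qed.

(** By causality nothing beyond [0, 1] is seen. It serves where an equality is known on [0, 1] only:
    the formula for T^n, and the passage to a continuous extension. *)
Lemma eq_tconv01 f g : (forall x, 0 <= x <= 1 -> f x = g x) ->
  forall x, 0 <= x <= 1 -> tconv f x = tconv g x.
Proof.
move=> fg x /andP[x0 x1].
rewrite /tconv /idVolterra fg ?x0//; congr (_ - _ + _).
  apply: eq_Rintegral => t /set_mem/=; rewrite in_itv/= => /andP[t0 tx].
  by rewrite fg// t0 (le_trans tx).
case: ifP => // hx; rewrite fg// subr_ge0 hx/=.
by rewrite (le_trans _ x1)// gerBl ltW// half01.
Qed.

Lemma iter_tconvE n f x : causal f -> 0 <= x <= 1 ->
  iter n tconv f x = iter n (@idVolterra R) f x +
                    n%:R * iter n.-1 (@idVolterra R) f (x - 2^-1).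
Proof.
move=> cf; elim: n x => [|n IH] x x01; first by rewrite /= mul0r addr0.
rewrite iterS (eq_tconv01 IH)//.
have cn m : causal (iter m (@idVolterra R) f) by exact: causal_iter_idVolterra.
have cs := causal_shift_half (cn n.-1).
have csZ := causalZ n%:R cs.
rewrite tconvD ?tconvZ// !tconvE// idVolterra_shift ?(ltW half01)//.
(* S^2 = 0 enters here: the double shift lands at x - 1 <= 0. This is why x <= 1 is assumed, the
   functions themselves continuing past 1. *)
have -> : iter n.-1 (@idVolterra R) f (x - 2^-1 - 2^-1) = 0.
  by apply: (cn n.-1).2; move/andP: x01 => [_]; lra.
have -> : n%:R * (idVolterra (iter n.-1 (@idVolterra R) f) (x - 2^-1) + 0) =
    n%:R * iter n (@idVolterra R) f (x - 2^-1).
  by rewrite addr0; case: (n) => [|m]; rewrite ?mul0r.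
by rewrite -natr1 /=; ring.
Qed.

(** A rate with a single constant, rather than mere convergence: sums and multiples are immediate,
    and the gliding hump gets explicit thresholds. *)
Definition vanishing F := causal F /\ exists C, forall n x, 0 <= x <= 1 ->
  n.+1%:R * `|iter n tconv F x| <= C.

Lemma vanishingD f g : vanishing f -> vanishing g ->
  vanishing (fun x => f x + g x).
Proof.
move=> [cf [C CP]] [cg [D DP]]; split; first exact: causalD.
exists (C + D) => n x x01.
rewrite iter_tconvD// (le_trans _ (lerD (CP n x x01) (DP n x x01)))//.
by rewrite -mulrDr ler_wpM2l ?ler_normD.
Qed.

Lemma vanishingZ a f : vanishing f -> vanishing (fun x => a * f x).
Proof.
move=> [cf [C CP]]; split; first exact: causalZ.
exists (`|a| * C) => n x x01; rewrite iter_tconvZ// normrM mulrCA.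
by rewrite ler_wpM2l// CP.
Qed.

Lemma vanishing0 : vanishing (fun=> 0).
Proof.
have c0 : causal (fun=> 0 : R) by split => // x; exact: cvg_cst.
split=> //; exists 0 => n x _.
suff -> : iter n tconv (fun=> 0) = fun=> 0 by rewrite normr0 mulr0.
have := iter_tconvZ n 0 c0.
rewrite [X in iter n tconv X](_ : _ = fun=> 0); last by apply/funext => ?; rewrite mul0r.
by move=> ->; apply/funext => ?; rewrite mul0r.
Qed.

Lemma vanishing_volterra5 h : causal h -> vanishing (iter 5 V h).
Proof.
move=> ch; have cf := causal_iter_volterra 5 ch; split => //.
have [C CP] := decay2_volterra5 ch; set f := iter 5 V h in CP cf *.
have C0 : 0 <= C.
  have := CP 0%N 0; rewrite lexx ler01 => /(_ isT); apply: le_trans.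
  by rewrite mulr_ge0// exprn_ge0.
(* One C for (I - V)^n f and two for the shifted term, where the weight is (n + 2) (n + 1) <= 2 (n +
   1)^2 once n is replaced by n + 1. *)
exists (3 * C) => n x x01; rewrite iter_tconvE//.
have B1 : n.+1%:R * `|iter n (@idVolterra R) f x| <= C.
  apply: le_trans (CP n x x01); rewrite expr2 ler_wpM2r//.
  by rewrite ler_peMr// ler1n.
apply: (@le_trans _ _ (C + 2 * C)); last lra.
apply: (le_trans (ler_wpM2l _ (ler_normD _ _))) => //; rewrite mulrDr.
apply: lerD => //; rewrite normrM ger0_norm//.
case: n {B1} => [|n]; first by rewrite mul0r mulr0 mulr_ge0.
rewrite succnK.
have [xh|xh] := leP x 2^-1.
  have -> : iter n (@idVolterra R) f (x - 2^-1) = 0.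
    by apply: (causal_iter_idVolterra n cf).2; rewrite subr_le0.
  by rewrite normr0 !mulr0 mulr_ge0.
have x01' : 0 <= x - 2^-1 <= 1 by move/andP: x01; lra.
apply: le_trans (ler_wpM2l (ler0n R 2) (CP n _ x01')).
rewrite !mulrA ler_wpM2r//.
by rewrite ler_wpM2r// -natrM ler_nat; lia.
Qed.

(* x ^ n.+1 / n.+1`! for x >= 0, and 0 for x <= 0. *)
Definition ramp n : R -> R := iter n V (fun x => Num.max x 0).

Lemma causal_ramp n : causal (ramp n).
Proof.
apply: causal_iter_volterra; split; last by move=> x x0; rewrite max_r.
by move=> x; apply: continuous_max; [exact: cvg_id|exact: cvg_cst].
Qed.

Lemma volterra_gt0 f : causal f -> (forall x, 0 < x -> 0 < f x) ->
  forall x, 0 < x -> 0 < V f x.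
Proof.
move=> cf f0 x x0.
have [|c /[!in_itv]/= /andP[c0 _]] := MVT x0 (fun x _ => is_derive_volterra x cf).
  by apply: continuous_subspaceT; exact: (causal_volterra cf).1.
by rewrite [volterra f 0]volterra_le0// !subr0 => ->; rewrite mulr_gt0// f0.
Qed.

Lemma ramp_gt0 n x : 0 < x -> 0 < ramp n x.
Proof.
elim: n x => [|n IH] x x0; first by rewrite /ramp/= lt_max x0.
by apply: volterra_gt0 => //; exact: causal_ramp.
Qed.

Lemma ramp_ge0 n x : 0 <= ramp n x.
Proof.
have [x0|x0] := leP x 0; first by rewrite (causal_ramp n).2.
exact/ltW/ramp_gt0.
Qed.

Lemma norm_volterra_le f c x : causal f -> 0 <= x <= 1 ->
  (forall t, 0 <= t <= 1 -> `|f t| <= c) -> `|V f x| <= c.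
Proof.
move=> cf /andP[x0 x1] fc.
have c0 : 0 <= c by rewrite (le_trans _ (fc 0 _))// lexx ler01.
have cx : c * x <= c by rewrite ler_piMr.
have B g : causal g -> (forall t, 0 <= t <= 1 -> `|g t| <= c) -> V g x <= c.
  move=> cg gc; apply: le_trans cx; apply: volterra_le_cst; rewrite ?cg.1//.
    exact: cg.1.
  move=> t /andP[t0 tx]; apply: (le_trans (ler_norm _)); apply: gc.
  by rewrite t0 (le_trans tx).
rewrite ler_norml B// andbT lerNl.
have := B (fun x => -1 * f x) (causalZ _ cf).
by rewrite volterraZ// mulN1r; apply => t t01; rewrite mulN1r normrN fc.
Qed.

Lemma ramp_le1 n x : 0 <= x <= 1 -> `|ramp n x| <= 1.
Proof.
elim: n x => [|n IH] x x01.
  rewrite /ramp/= max_l ?ger0_norm; by case/andP: x01.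
by apply: norm_volterra_le => //; exact: causal_ramp.
Qed.

Definition cosy y x := cos (y * x).
Definition siny y x := sin (y * x).

Lemma is_derive_mull y x : is_derive x 1 (fun t => y * t) y.
Proof. by have := is_derive1Z y (is_derive_id x (1:R)); rewrite mulr1. Qed.

Lemma is_derive_cosy y x : is_derive x 1 (cosy y) (- y * siny y x).
Proof.
have := @is_derive1_comp _ (@cos R) (fun t => y * t) x _ _
  (is_derive_cos _) (is_derive_mull y x).
by rewrite /siny mulrC mulrN mulNr.
Qed.

Lemma is_derive_siny y x : is_derive x 1 (siny y) (y * cosy y x).
Proof.
have := @is_derive1_comp _ (@sin R) (fun t => y * t) x _ _
  (is_derive_sin _) (is_derive_mull y x).
by rewrite mulrC.
Qed.

Lemma continuous_derivable f (df : R -> R) :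
  (forall x, is_derive x 1 f (df x)) -> continuous f.
Proof.
move=> d x; apply: differentiable_continuous; apply/derivable1_diffP.
by case: (d x).
Qed.

Lemma continuous_cosy y : continuous (cosy y).
Proof. exact: continuous_derivable (is_derive_cosy y). Qed.

Lemma continuous_siny y : continuous (siny y).
Proof. exact: continuous_derivable (is_derive_siny y). Qed.

Lemma norm_cosy y x : `|cosy y x| <= 1.
Proof. by rewrite ler_norml cos_geN1 cos_le1. Qed.

Lemma norm_siny y x : `|siny y x| <= 1.
Proof. by rewrite ler_norml sin_geN1 sin_le1. Qed.

Lemma causal_cosy_ramp n y : causal (fun x => cosy y x * ramp n x).
Proof. by apply: causalM; [exact: continuous_cosy|exact: causal_ramp]. Qed.

Lemma causal_siny_ramp n y : causal (fun x => siny y x * ramp n x).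
Proof. by apply: causalM; [exact: continuous_siny|exact: causal_ramp]. Qed.

(** The product rule with (ramp n.+1)' = ramp n. Together with [siny_rampE] it trades one degree of
    the ramp for one factor V. Solved for V (cos ramp), [siny_rampE] is an integration by parts that
    gains 1/y. *)
Lemma cosy_rampE n y : (fun x => cosy y x * ramp n.+1 x) =
  V (fun x => (- y) * (siny y x * ramp n.+1 x) + cosy y x * ramp n x).
Proof.
apply: volterra_unique.
- apply: causalD; last exact: causal_cosy_ramp.
  by apply: causalZ; exact: causal_siny_ramp.
- move=> x; rewrite mulrA; apply: is_derive1M; first exact: is_derive_cosy.
  by apply: is_derive_volterra; exact: causal_ramp.
- by rewrite (causal_ramp _).2 ?mulr0.
Qed.

Lemma siny_rampE n y : (fun x => siny y x * ramp n.+1 x) =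
  V (fun x => y * (cosy y x * ramp n.+1 x) + siny y x * ramp n x).
Proof.
apply: volterra_unique.
- apply: causalD; last exact: causal_siny_ramp.
  by apply: causalZ; exact: causal_cosy_ramp.
- move=> x; rewrite mulrA; apply: is_derive1M; first exact: is_derive_siny.
  by apply: is_derive_volterra; exact: causal_ramp.
- by rewrite (causal_ramp _).2 ?mulr0.
Qed.

Definition range_volterra j f := exists2 h, causal h & f = iter j V h.

Lemma range_volterraS j a f g : range_volterra j f -> range_volterra j g ->
  range_volterra j.+1 (V (fun x => a * f x + g x)).
Proof.
move=> [h ch ->] [k ck ->]; exists (fun x => a * h x + k x).
  by apply: causalD => //; exact: causalZ.
rewrite iterS; congr volterra; rewrite iter_volterraD//; last exact: causalZ.
apply/funext => x; congr (_ + _).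
suff -> : iter j V (fun x => a * h x) = fun x => a * iter j V h x by [].
elim: j => //= j ->; rewrite volterraZ//; exact: causal_iter_volterra.
Qed.

(** Cosine and sine go together because the derivative of each involves the other, and [i] is
    general because the step uses the ramps of index [i] and [i.+1] for the same [j]. *)
Lemma range_cosy_siny j i y : (j <= i)%N ->
  range_volterra j (fun x => cosy y x * ramp i x) /\
  range_volterra j (fun x => siny y x * ramp i x).
Proof.
elim: j i => [|j IH] i ji.
  split; [exists (fun x => cosy y x * ramp i x)|
          exists (fun x => siny y x * ramp i x)] => //.
    exact: causal_cosy_ramp.
  exact: causal_siny_ramp.
case: i ji => // i ji.
have [ci si] := IH i ji; have [cSi sSi] := IH i.+1 (leqW ji).
by rewrite cosy_rampE siny_rampE; split; exact: range_volterraS.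
Qed.

(** Index 5 is the least that [range_cosy_siny] allows for the range of V^5. *)
Definition packet y x := cosy y x * ramp 5 x.

Lemma causal_packet y : causal (packet y).
Proof. exact: causal_cosy_ramp. Qed.

Lemma vanishing_packet y : vanishing (packet y).
Proof.
have [[h ch E] _] := @range_cosy_siny 5 5 y (leqnn _).
by rewrite /packet E; exact: vanishing_volterra5.
Qed.

Lemma norm_packet y x : 0 <= x <= 1 -> `|packet y x| <= 1.
Proof. by move=> x01; rewrite normrM mulr_ile1 ?norm_cosy ?ramp_le1. Qed.

Lemma volterra_packet y x : 0 < y -> 0 <= x <= 1 -> `|V (packet y) x| <= 2 / y.
Proof.
move=> y0 x01; rewrite ler_pdivlMr// mulrC -[X in X * _](ger0_norm (ltW y0)) -normrM.
have -> : y * V (packet y) x =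
    siny y x * ramp 5 x - V (fun t => siny y t * ramp 4 t) x.
  have := congr1 (@^~ x) (siny_rampE 4 y).
  rewrite (volterraD (causalZ y (causal_packet y)) (causal_siny_ramp 4 y)).
  by rewrite (volterraZ y (causal_packet y)) => ->; rewrite addrK.
apply: (le_trans (ler_normB _ _)); rewrite -[leRHS]/(1 + 1); apply: lerD.
  by rewrite normrM mulr_ile1 ?norm_siny ?ramp_le1.
apply: norm_volterra_le x01 _; first exact: causal_siny_ramp.
by move=> t t01; rewrite normrM mulr_ile1 ?norm_siny ?ramp_le1.
Qed.

Lemma iter_idVolterra_packet n y x : 0 < y -> 0 <= x <= 1 ->
  `|iter n (@idVolterra R) (packet y) x - packet y x| <= 3 ^+ n * (2 / y).
Proof.
have cy := causal_packet y.
move=> y0; elim: n x => [|n IH] x x01.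
  by rewrite subrr normr0 mulr_ge0// divr_ge0// ltW.
have cn : causal (iter n (@idVolterra R) (packet y)) by exact: causal_iter_idVolterra.
set g := fun x => iter n (@idVolterra R) (packet y) x - packet y x.
have cg : causal g by exact: causalB.
(* With g the error after n steps, the next error is g - V g - V (packet), and each of the three
   terms is at most 3^n (2/y). *)
have -> : iter n.+1 (@idVolterra R) (packet y) x - packet y x =
    g x - V g x - V (packet y) x.
  rewrite /g volterraB// iterS {1}/idVolterra; ring.
have b1 := IH x x01; rewrite -/(g x) in b1.
have b2 : `|V g x| <= 3 ^+ n * (2 / y) by exact: norm_volterra_le.
have b3 := volterra_packet y0 x01.
have b4 : 1 * (2 / y) <= 3 ^+ n * (2 / y).
  apply: ler_wpM2r; first by rewrite divr_ge0// ltW.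
  by rewrite exprn_ege1// ler1n.
rewrite exprS -mulrA.
have := ler_normB (g x - V g x) (V (packet y) x).
have := ler_normB (g x) (V g x).
lra.
Qed.

(** A lower bound uniform in y: |cos| >= cos^2 = (1 + cos 2y)/2, and the oscillating half integrates
    to O(1/y). The integral stops at 1/2 because S p on [0, 1] sees p on [0, 1/2] only. *)
Lemma volterra_norm_packet : exists2 c, 0 < c & forall y, c^-1 <= y ->
  c <= V (fun x => `|packet y x|) 2^-1.
Proof.
have h1 : 0 < V (ramp 5) 2^-1.
  by apply: (@ramp_gt0 6); exact: half01.
set c0 := V _ _ in h1; exists (c0 / 4); first by rewrite divr_gt0.
move=> y; rewrite invf_div ler_pdivrMr// => cy.
have y0 : 0 < y by have := h1; nra.
have cy2 := causal_packet (2 * y).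
have cN : causal (fun x => `|packet y x|).
  by apply: causal_norm; exact: causal_packet.
have cs : causal (fun x => ramp 5 x + packet (2 * y) x).
  by apply: causalD => //; exact: causal_ramp.
have c2 := causalZ 2^-1 cs.
apply: (@le_trans _ _ (V (fun x => 2^-1 * (ramp 5 x + packet (2 * y) x)) 2^-1)).
  have E := volterraZ 2^-1 cs; cbv beta in E.
  rewrite E volterraD//; last exact: causal_ramp.
  have := @volterra_packet (2 * y) 2^-1; rewrite mulr_gt0// => /(_ isT).
  have h01 : 0 <= (2^-1 : R) <= 1 by lra.
  move=> /(_ h01); rewrite ler_norml => /andP[+ _].
  rewrite -/c0 => B.
  have : 2 / (2 * y) <= c0 / 4.
    by rewrite invfM mulrA divff// mul1r -div1r ler_pdivrMr//; lra.
  lra.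
apply: le_volterra; [exact: c2.1|exact: cN.1|] => t _.
have -> : 2^-1 * (ramp 5 t + packet (2 * y) t) = ramp 5 t * cosy y t ^+ 2.
  rewrite /packet /cosy -mulrA mulr_natl cosD -expr2 -expr2.
  by rewrite sin2cos2; field.
rewrite /packet normrM mulrC (ger0_norm (ramp_ge0 _ _)) ler_wpM2r ?ramp_ge0//.
by rewrite -real_normK ?num_real// expr2 ler_piMr// norm_cosy.
Qed.

End Growth.
Arguments tconv {R} f x.


(** * The gliding hump *)

Section GlidingHump.
Variable R : realType.
Implicit Types (f g h F u : R -> R) (a c x y : R).
Local Notation V := (@volterra R).

Lemma nat_ge_eventually x : exists m0, forall m, (m0 <= m)%N -> x <= m%:R.
Proof.
exists (Num.truncn x).+1 => m mm; apply: (@le_trans _ _ (Num.truncn x).+1%:R).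
  by apply: ltW; apply: truncnS_gt.
by rewrite ler_nat.
Qed.

(** Order of the choices: m after F and N, so that T^m F is at most 1 and 9^-N m is large; the
    frequency after m; n after the sum F + phi, which is again vanishing. At time m the term 9^-N m
    S p dominates all others. *)
Lemma growth_step F N : vanishing F -> exists phi N',
  [/\ vanishing phi, (N < N')%N,
      forall x, 0 <= x <= 1 -> `|phi x| <= 9 ^- N,
      exists2 m, (N <= m <= N')%N &
        N%:R <= V (fun x => `|iter m tconv (fun t => F t + phi t) x|) 1 &
      exists2 n, (N <= n <= N')%N & forall x, 0 <= x <= 1 ->
        `|iter n tconv (fun t => F t + phi t) x| <= N.+1%:R^-1].
Proof.
move=> vF; have [cF [C CP]] := vF; have [c c0 cP] := volterra_norm_packet R.
have e0 : 0 < (9 ^+ N)^-1 :> R by rewrite invr_gt0 exprn_gt0.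
have e1 : 9 ^- N <= 1 :> R by rewrite invf_le1 ?exprn_gt0// exprn_ege1// ler1n.
set e := 9 ^- N in e0 e1 *; clearbody e.
have [m1 m1P] := nat_ge_eventually C.
(* The 4 pays for the errors at time m: 1 for T^m F, 2 for (I - V)^m p, and 1 for replacing (I -
   V)^(m-1) p by p in the shifted term. *)
have [m2 m2P] := nat_ge_eventually ((N%:R + 4) / (e * c)).
pose m := maxn N (maxn m1 m2).
have Nm : (N <= m)%N by rewrite leq_maxl.
have Cm : C <= m%:R by apply: m1P; rewrite /m; lia.
have ecm : N%:R + 4 <= e * m%:R * c.
  by rewrite mulrAC -ler_pdivrMl ?mulr_gt0// mulrC; apply: m2P; rewrite /m; lia.
pose b : R := 2 * 3 ^+ m * m.+1%:R.
have b0 : 0 < b by rewrite !mulr_gt0// exprn_gt0.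
(* [c^-1] is the threshold of [volterra_norm_packet]; [b] keeps the distance from (I - V)^k p to p
   below 1/(m + 1) for all k <= m. *)
pose y := c^-1 + b.
have y0 : 0 < y by rewrite addr_gt0// invr_gt0.
have small k : (k <= m)%N -> m.+1%:R * (3 ^+ k * (2 / y)) <= 1 :> R.
  move=> km; rewrite !mulrA ler_pdivrMr// mul1r.
  apply: (@le_trans _ _ b); last by rewrite lerDr ltW// invr_gt0.
  rewrite (_ : _ * _ = 2 * 3 ^+ k * m.+1%:R); last by ring.
  rewrite ler_wpM2r// ler_wpM2l//.
  by rewrite ler_weXn2l// ler1n.
(* From here on the packet enters through these four properties only. *)
have [p [vp np bp Vp]] : exists p, [/\ vanishing p,
    forall x, 0 <= x <= 1 -> `|p x| <= 1,
    forall k x, 0 <= x <= 1 ->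
      `|iter k (@idVolterra R) p x - p x| <= 3 ^+ k * (2 / y) &
    c <= V (fun x => `|p x|) 2^-1].
  exists (packet y); split.
  - exact: vanishing_packet.
  - by move=> x; exact: norm_packet.
  - by move=> k x; exact: iter_idVolterra_packet.
  - by apply: cP; rewrite lerDl ltW.
have cpk := vp.1.
pose phi x := e * p x.
have vphi : vanishing phi by exact: vanishingZ.
have vG := vanishingD vF vphi; have [cG [D DP]] := vG.
have [n1 n1P] := nat_ge_eventually (D * N.+1%:R).
pose n := maxn N n1.
exists phi, (maxn m n).+1; split => //.
- by rewrite /m; lia.
- move=> x x01; rewrite normrM (gtr0_norm e0).
  by apply: ler_piMr; [exact: ltW|exact: np].
- exists m; first by rewrite /m; lia.
  set H := iter m tconv _.
  have cH : causal H by exact: causal_iter_tconv.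
  have cN : causal (fun x => `|H x|) by exact: causal_norm.
  have cp : causal (fun x => `|p x|) by apply: causal_norm.
  have cS := causal_shift_half cp.
  have cZ := causalZ (e * m%:R) cS.
  have cd := causalB cZ cN.
  have h1 : V (fun x => e * m%:R * `|p (x - 2^-1)|) 1 = e * m%:R * V (fun x => `|p x|) 2^-1.
    transitivity (e * m%:R * V (fun x => `|p (x - 2^-1)|) 1).
      exact: (congr1 (@^~ 1) (volterraZ (e * m%:R) cS)).
    transitivity (e * m%:R * V (fun x => `|p x|) (1 - 2^-1)).
      congr (_ * _).
      exact: (congr1 (@^~ 1) (volterra_shift (ltW (half01 R)) cp)).
    by congr (_ * V _ _); lra.
  have : V (fun x => e * m%:R * `|p (x - 2^-1)| - `|H x|) 1 <= 4 * 1.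
    apply: volterra_le_cst => //; first exact: cd.1.
    move=> x x01; rewrite lerBlDr.
    have HE : H x = iter m tconv F x + e * (iter m (@idVolterra R) p x +
        m%:R * iter m.-1 (@idVolterra R) p (x - 2^-1)).
      rewrite /H (iter_tconvD m cF vphi.1) (iter_tconvZ m e cpk).
      by rewrite (iter_tconvE m cpk x01).
    have bF : `|iter m tconv F x| <= 1.
      have m0 : 0 < m.+1%:R :> R by [].
      rewrite -(ler_pM2l m0); apply: le_trans (le_trans (CP m x x01) Cm) _.
      by rewrite mulr1 ler_nat.
    have bpm : `|iter m (@idVolterra R) p x| <= 2.
      have := bp m x x01.
      have := np x x01.
      have := small m (leqnn _).
      have : 1 * (3 ^+ m * (2 / y)) <= m.+1%:R * (3 ^+ m * (2 / y)).
        by rewrite ler_wpM2r ?ler1n// mulr_ge0 ?exprn_ge0// divr_ge0// ltW.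
      have := lerB_dist (iter m (@idVolterra R) p x) (p x).
      lra.
    have bs : m%:R * `|iter m.-1 (@idVolterra R) p (x - 2^-1) - p (x - 2^-1)| <= 1.
      have [xh|xh] := leP x 2^-1.
        have -> : iter m.-1 (@idVolterra R) p (x - 2^-1) = 0.
          by apply: (causal_iter_idVolterra _ cpk).2; rewrite subr_le0.
        by rewrite cpk.2 ?subr_le0// subrr normr0 mulr0.
      have x01' : 0 <= x - 2^-1 <= 1 by move/andP: x01; lra.
      apply: le_trans (small m.-1 (leq_pred m)).
      apply: ler_pM => //; first by rewrite ler_nat.
      exact: bp.
    set u := iter m _ p x in HE bpm; set v := iter m.-1 _ _ _ in HE bs.
    set q := p _ in bs *; set A := iter m tconv F x in HE bF.
    have -> : e * m%:R * `|q| = `|H x - A - e * u - e * (m%:R * (v - q))|.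
      rewrite HE -[in LHS](gtr0_norm e0) -[X in _ * X * _](ger0_norm (ler0n R m)) -!normrM.
      by congr `|_|; ring.
    have bev : `|e * (m%:R * (v - q))| <= 1.
      by rewrite normrM gtr0_norm// normrM normr_nat mulr_ile1// ltW.
    have beu : `|e * u| <= 2.
      by rewrite normrM gtr0_norm// -[leRHS]mul1r ler_pM// ltW.
    have := ler_normB (H x - A - e * u) (e * (m%:R * (v - q))).
    have := ler_normB (H x - A) (e * u).
    have := ler_normB (H x) A.
    lra.
  have -> : V (fun x => e * m%:R * `|p (x - 2^-1)| - `|H x|) 1 =
      V (fun x => e * m%:R * `|p (x - 2^-1)|) 1 - V (fun x => `|H x|) 1.
    exact: (congr1 (@^~ 1) (volterraB cZ cN)).
  rewrite h1.
  have : e * m%:R * c <= e * m%:R * V (fun x => `|p x|) 2^-1.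
    by rewrite ler_wpM2l// mulr_ge0// ltW.
  lra.
- exists n; first by rewrite /n; lia.
  move=> x x01; rewrite -[leRHS]mul1r ler_pdivlMr//.
  have n0 : 0 < n.+1%:R :> R by [].
  rewrite -(ler_pM2l n0) mulr1 mulrA.
  apply: (@le_trans _ _ (D * N.+1%:R)); first by rewrite ler_wpM2r// DP.
  by apply: n1P; rewrite /n; lia.
Qed.

End GlidingHump.


(** * The limit of the humps and its orbit *)

Section Limit.
Variable R : realType.
Implicit Types (f g h F u : R -> R) (a c x y : R).
Local Notation V := (@volterra R).

Lemma iter_tconv_bound n f c : causal f ->
  (forall x, 0 <= x <= 1 -> `|f x| <= c) ->
  forall x, 0 <= x <= 1 -> `|iter n tconv f x| <= 3 ^+ n * c.
Proof.
move=> cf fc; elim: n => [|n IH] x x01; first by rewrite expr0 mul1r fc.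
have cn := causal_iter_tconv n cf.
have c0 : 0 <= 3 ^+ n * c by apply: le_trans (IH x x01).
rewrite iterS exprS -mulrA {1}/tconv /idVolterra.
set g := iter n tconv f in IH cn *.
have b1 := IH x x01.
have b2 : `|V g x| <= 3 ^+ n * c by exact: norm_volterra_le.
have b3 : `|if 2^-1 <= x then g (x - 2^-1) else 0| <= 3 ^+ n * c.
  case: (leP 2^-1 x) => xh; last by rewrite normr0.
  by apply: IH; move/andP: x01; lra.
move: b3; set z := (if _ then _ else _) => b3.
have := ler_normD (g x - V g x) z; have := ler_normB (g x) (V g x).
lra.
Qed.

(** The times of stage k lie between N k and N k.+1, while the humps added later have size at most
    9^-N(k+1): the limit inherits what each stage achieves. *)
Lemma hump_sequence : exists (F : nat -> R -> R) (N : nat -> nat),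
  [/\ forall k, causal (F k),
      forall k, (k <= N k < N k.+1)%N,
      forall k x, 0 <= x <= 1 -> `|F k.+1 x - F k x| <= 9 ^- N k,
      forall k, exists2 m, (N k <= m <= N k.+1)%N &
        (N k)%:R <= V (fun x => `|iter m tconv (F k.+1) x|) 1 &
      forall k, exists2 n, (N k <= n <= N k.+1)%N & forall x, 0 <= x <= 1 ->
        `|iter n tconv (F k.+1) x| <= (N k).+1%:R^-1].
Proof.
(* The state carries the invariant [vanishing], so that [growth_step] applies again; dependent
   choice becomes iteration of one step function. *)
pose state := ({F : R -> R | vanishing F} * nat)%type.
have /choice[step stepP] : forall s : state, exists s' : state,
  [/\ (s.2 < s'.2)%N,
      forall x, 0 <= x <= 1 -> `|sval s'.1 x - sval s.1 x| <= 9 ^- s.2,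
      exists2 m, (s.2 <= m <= s'.2)%N &
        s.2%:R <= V (fun x => `|iter m tconv (sval s'.1) x|) 1 &
      exists2 n, (s.2 <= n <= s'.2)%N & forall x, 0 <= x <= 1 ->
        `|iter n tconv (sval s'.1) x| <= s.2.+1%:R^-1].
  move=> [[F vF] N]; have [phi [N' [vphi NN' phiN mP nP]]] := growth_step N vF.
  exists (exist _ _ (vanishingD vF vphi), N'); split => //= x x01.
  by rewrite addrAC subrr add0r phiN.
pose s k : state := iter k step (exist _ _ (vanishing0 R), 0%N).
pose F k := sval (s k).1; pose N k := (s k).2.
have sP k := stepP (s k).
have Ninc k : (N k < N k.+1)%N by have [+ _ _ _] := sP k.
exists F, N; split=> k.
- exact: (svalP (s k).1).1.
- rewrite Ninc andbT; elim: k => // k IH; exact: leq_ltn_trans (Ninc k).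
- by have [_ + _ _] := sP k.
- by have [_ _ + _] := sP k.
- by have [_ _ _ +] := sP k.
Qed.

Theorem irregular_tconv : exists f, [/\ causal f,
  forall (e : R) N, 0 < e -> exists2 n, (N <= n)%N &
    forall x, 0 <= x <= 1 -> `|iter n tconv f x| <= e &
  forall (A : R) N, exists2 m, (N <= m)%N & A <= V (fun x => `|iter m tconv f x|) 1].
Proof.
have [F [N [cF Nle FN mP nP]]] := hump_sequence.
have Nge k : (k <= N k)%N by case/andP: (Nle k).
have Ninc k : (N k < N k.+1)%N by case/andP: (Nle k).
pose clamp x : R := Num.min x 1.
(* Freezing the functions at their value at 1 makes the convergence uniform on the whole line: the
   humps are controlled on [0, 1] only. *)
have clamp01 x : 0 < x -> 0 <= clamp x <= 1.
  by move=> x0; rewrite /clamp le_min ltW// ler01/= ge_min lexx orbT.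
have clampid x : 0 <= x <= 1 -> clamp x = x.
  by case/andP=> _ x1; rewrite /clamp min_l.
(* A telescoping majorant of the remaining humps: d k.+1 <= d k / 9, hence d k - d k.+1 >=
   9^-N(k). *)
pose d k : R := 2 * 9 ^- N k.
have d0 k : 0 < d k by rewrite mulr_gt0// invr_gt0 exprn_gt0.
have dS k : 9 ^- N k <= d k - d k.+1.
  have : 9 ^- N k.+1 <= 9 ^- (N k).+1 :> R.
    by rewrite lef_pV2 ?posrE ?exprn_gt0// ler_weXn2l// ler1n.
  rewrite exprS invfM /d; have : 0 < (9 ^+ N k)^-1 :> R.
    by rewrite invr_gt0 exprn_gt0.
  lra.
have FS k x : `|F k.+1 (clamp x) - F k (clamp x)| <= d k - d k.+1.
  apply: le_trans (dS k).
  have [x0|x0] := leP x 0.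
    have cx : clamp x <= 0 by rewrite /clamp ge_min x0.
    by rewrite !(cF _).2// subrr normr0 invr_ge0 exprn_ge0.
  by apply: FN; exact: clamp01.
have Fk k j x : `|F (j + k)%N (clamp x) - F k (clamp x)| <= d k - d (j + k)%N.
  elim: j => [|j IH]; first by rewrite add0n !subrr normr0.
  rewrite addSn; have := FS (j + k)%N x.
  have := ler_normD (F (j + k).+1 (clamp x) - F (j + k)%N (clamp x))
                    (F (j + k)%N (clamp x) - F k (clamp x)).
  by rewrite addrA subrK; lra.
have dlim : d @ \oo --> 0.
  have g9 : (fun k : nat => 2 * (9^-1) ^+ k : R) @ \oo --> (2 * 0 : R).
    apply: cvgM; first exact: cvg_cst.
    by apply: cvg_expr; rewrite ger0_norm ?invr_ge0// invf_lt1// ltr1n.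
  rewrite mulr0 in g9.
  apply: (@squeeze_cvgr _ _ _ _ (fun=> 0) (fun k => 2 * (9^-1) ^+ k)) => //.
    apply: nearW => k; rewrite ltW//= /d ler_wpM2l// -exprVn.
    by rewrite ler_wiXn2l ?invr_ge0// invf_le1// ler1n.
  exact: cvg_cst.
(* Adding d makes the sequence nonincreasing, so monotone convergence applies; d itself tends to
   0. *)
have cvF x : cvgn (fun k => F k (clamp x)).
  have : cvgn (fun k => F k (clamp x) + d k).
    apply: nonincreasing_is_cvgn.
      apply/nonincreasing_seqP => k; have := FS k x.
      by rewrite ler_norml => /andP[]; lra.
    exists (F 0 (clamp x) - d 0) => _ [k _ <-].
    have := Fk 0%N k x; rewrite addn0 ler_norml => /andP[]; have := d0 k; lra.
  move=> /cvg_ex[l fl]; apply/cvg_ex; exists (l - 0).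
  rewrite (_ : (fun k => _) = (fun k => F k (clamp x) + d k) - d).
    exact: cvgB.
  by apply/funext => k; rewrite !fctE addrK.
pose f x := limn (fun k => F k (clamp x)).
have fF k x : `|f x - F k (clamp x)| <= d k.
  have c1 : (fun j => `|F (j + k)%N (clamp x) - F k (clamp x)|) @ \oo -->
      `|f x - F k (clamp x)|.
    apply: cvg_norm; apply: cvgB; last exact: cvg_cst.
    have := cvF x; rewrite /f -(cvg_shiftn k) => h; exact: h.
  rewrite -(cvg_lim _ c1)//; apply: limr_le; first by apply/cvg_ex; eexists; exact: c1.
  apply: nearW => j; apply: le_trans (Fk k j x) _; have := d0 (j + k)%N; lra.
have cf : causal f.
  split; last first.
    move=> x x0; have cx : clamp x <= 0 by rewrite /clamp ge_min x0.
    rewrite /f (_ : (fun k => _) = fun=> 0); first exact: lim_cst.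
    by apply/funext => k; rewrite (cF k).2.
  move=> x; apply/cvgrPdist_le => e e0.
  have e3 : 0 < e / 3 by rewrite divr_gt0.
  have /cvgrPdist_le/(_ _ e3)[k _ kP] := dlim.
  have dk : d k <= e / 3.
    by have := kP k (leqnn k); rewrite /= sub0r normrN gtr0_norm.
  have cFk : {for x, continuous (fun t => F k (clamp t))}.
    apply: (@continuous_comp _ _ _ clamp (F k)); last exact: (cF k).1.
    by apply: continuous_min; [exact: cvg_id|exact: cvg_cst].
  have /cvgrPdist_le/(_ _ e3) near_t := cFk.
  near=> t.
  have ht : `|F k (clamp x) - F k (clamp t)| <= e / 3.
    by near: t.
  have h1 := fF k x; have h2 := fF k t.
  rewrite (_ : f x - f t = (f x - F k (clamp x)) +
    (F k (clamp x) - F k (clamp t)) - (f t - F k (clamp t))); last by ring.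
  set p := f x - _ in h1 *; set q := F k _ - _ in ht *; set r := f t - _ in h2 *.
  have := ler_normB (p + q) r; have := ler_normD p q; lra.
(* The amplitude pays off: for n <= N, 3^n times the distance 2 * 9^-N from f to F k is at most 2 *
   3^-N, with N = N k. *)
have near_iter k n x : (n <= N k)%N -> 0 <= x <= 1 ->
    `|iter n tconv f x - iter n tconv (F k) x| <= 2 * 3 ^- N k.
  move=> nN x01; pose g t := f t - F k t.
  have cg : causal g by exact: causalB.
  have gd t : 0 <= t <= 1 -> `|g t| <= d k.
    by move=> t01; have := fF k t; rewrite clampid.
  have -> : iter n tconv f x - iter n tconv (F k) x = iter n tconv g x.
    have -> : f = fun t => g t + F k t by apply/funext => t; rewrite /g subrK.
    by rewrite (iter_tconvD n cg (cF k)) addrK.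
  apply: le_trans (iter_tconv_bound n cg gd x01) _.
  rewrite /d mulrCA ler_wpM2l//.
  have -> : 9 = 3 * 3 :> R by rewrite -natrM.
  rewrite exprMn invfM mulrA ler_piMl ?invr_ge0 ?exprn_ge0//.
  by rewrite ler_pdivrMr ?exprn_gt0// mul1r ler_weXn2l// ler1n.
have lt13 n : 3 ^- n <= 1 :> R.
  by rewrite invf_le1 ?exprn_gt0// exprn_ege1// ler1n.
exists f; split => // [e M e0|A M].
(* The final bound is 3 / (N k + 1): two parts from [near_iter], one from [nP]. *)
- have [k1 k1P] := nat_ge_eventually (3 / e).
  pose k := maxn M k1.
  have [n /andP[Nn nN] {}nP] := nP k.
  exists n; first by have := Nge k; lia.
  move=> x x01; have h1 := near_iter k.+1 n x nN x01; have h2 := nP x x01.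
  have h3 : 3 / e <= (N k).+1%:R.
    by apply: k1P; have := Nge k; lia.
  have h4 : 3 ^- N k.+1 <= (N k).+1%:R^-1 :> R.
    rewrite lef_pV2 ?posrE ?exprn_gt0// -natrX ler_nat.
    by apply: leq_trans (ltnW (ltn_expl _ (isT : (1 < 3)%N))); exact: Ninc.
  have h5 : 3 * (N k).+1%:R^-1 <= e.
    by rewrite ler_pdivrMr// -ler_pdivrMl// mulrC.
  have := ler_normD (iter n tconv f x - iter n tconv (F k.+1) x) (iter n tconv (F k.+1) x).
  rewrite subrK; move: h1 h2 h4 h5; move: (3 ^- _) (_%:R^-1) => a b; lra.
(* The 2 covers the loss from [F k.+1] to f, since 2 * 3^-N <= 2. *)
- have [k1 k1P] := nat_ge_eventually (A + 2).
  pose k := maxn M k1.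
  have [m /andP[Nm mN] {}mP] := mP k.
  exists m; first by have := Nge k; lia.
  have h3 : A + 2 <= (N k)%:R by apply: k1P; have := Nge k; lia.
  have c1 := causal_norm (causal_iter_tconv m (cF k.+1)).
  have c2 := causal_norm (causal_iter_tconv m cf).
  have : V (fun x => `|iter m tconv (F k.+1) x| - `|iter m tconv f x|) 1 <= 2 * 1.
    apply: volterra_le_cst => //; first exact: (causalB c1 c2).1.
    move=> x x01; have := near_iter k.+1 m x mN x01; have := lt13 (N k.+1).
    rewrite distrC => h1 h2.
    have := lerB_dist (iter m tconv (F k.+1) x) (iter m tconv f x); lra.
  have -> : V (fun x => `|iter m tconv (F k.+1) x| - `|iter m tconv f x|) 1 =
    V (fun x => `|iter m tconv (F k.+1) x|) 1 - V (fun x => `|iter m tconv f x|) 1.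
    exact: (congr1 (@^~ 1) (volterraB c1 c2)).
  lra.
Unshelve. all: end_near. Qed.

End Limit.


(** * The convolution measure *)

Section ChargeIntegral.
Variable R : realType.
Implicit Types (f g : R -> R) (a c x y : R).
Local Notation leb := (@lebesgue_measure R).
Local Notation mR := (measurableTypeR R).

(* The Hahn decomposition picked by [charge_integral] agrees with [(H, ~` H)]
   up to null sets. *)
Lemma charge_integralE (nu : {charge set mR -> \bar R})
    (m1 m2 : {measure set mR -> \bar R}) (H D : set mR) f :
  measurable H -> (m1 (~` H) = 0)%E -> (m2 H = 0)%E ->
  (forall A, measurable A -> nu A = m1 A - m2 A)%E ->
  charge_integral nu D f = Rintegral m1 D f - Rintegral m2 D f.
Proof.
move=> mH m1H m2H nuE.
have mHC := measurableC mH.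
have split_measure (m : {measure set mR -> \bar R}) A : measurable A ->
    m A = (m (A `&` H) + m (A `&` ~` H))%E.
  move=> mA; rewrite -measureU; [|exact: measurableI|exact: measurableI|].
    by rewrite -setIUr setUv setIT.
  by rewrite setIACA setICr setI0.
have m1I' A : measurable A -> m1 (A `&` ~` H) = 0%E.
  by move=> mA; apply: subset_measure0 m1H => //; exact: measurableI.
have m2I' A : measurable A -> m2 (A `&` H) = 0%E.
  by move=> mA; apply: subset_measure0 m2H => //; exact: measurableI.
have m1I A : measurable A -> m1 (A `&` H) = m1 A.
  by move=> mA; rewrite [in RHS]split_measure// m1I'// adde0.
have m2I A : measurable A -> m2 (A `&` ~` H) = m2 A.
  by move=> mA; rewrite [in RHS]split_measure// m2I'// add0e.
have hH : hahn_decomposition nu H (~` H).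
  split; last 2 first.
  - exact: setUv.
  - exact: setICr.
  - split=> // A mA AH; rewrite nuE// -[A in m2 A](setIidl AH) m2I'// sube0.
    exact: measure_ge0.
  - split=> [|A mA AH]; first exact: measurableC.
    by rewrite nuE// -[A in m1 A](setIidl AH) m1I'// sub0e oppe_le0 measure_ge0.
rewrite /charge_integral; set nuPN := (X in jordan_pos X).
have posE A : measurable A -> jordan_pos nuPN A = m1 A.
  move=> mA; rewrite jordan_posE cjordan_posE /crestr0 mem_set// /crestr.
  have [-> _] := Hahn_decomposition_uniq nuPN hH mA.
  by rewrite nuE ?m1I ?m2I' ?sube0//; exact: measurableI.
have negE A : measurable A -> jordan_neg nuPN A = m2 A.
  move=> mA; rewrite jordan_negE cjordan_negE /crestr0 mem_set// /crestr.
  have [_ ->] := Hahn_decomposition_uniq nuPN hH mA.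
  rewrite nuE ?m1I' ?m2I//; last by apply: measurableI => //; exact: measurableC.
  by rewrite sub0e oppeK.
by rewrite /Rintegral; congr (fine _ - fine _); apply: eq_measure_integral => A mA _;
  [exact: posE|exact: negE].
Qed.

Lemma charge_integral0 D f : charge_integral (czero : {charge set mR -> \bar R}) D f = 0.
Proof.
rewrite (@charge_integralE _ mzero mzero setT)//.
  by rewrite subrr.
by move=> A mA; rewrite /= /czero /mzero sube0.
Qed.

Let m01 : measurable (`[0, 1[%classic : set mR).
Proof. exact: measurable_itv. Qed.

Let fin01 : (leb `[0%R, 1%R[%classic < +oo)%E.
Proof. by rewrite lebesgue_measure_itv/= lte01 sube0 ltry. Qed.

Definition two_atoms : {charge set mR -> \bar R} :=
  cadd (charge_of_finite_measure (dirac (0 : mR)))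
       (charge_of_finite_measure (dirac (2^-1 : mR))).

Definition conv_charge : {charge set mR -> \bar R} :=
  cadd two_atoms (copp (charge_of_finite_measure (mfrestr m01 fin01))).

Let conv_chargeE A :
  (conv_charge A = \d_(0%R : mR) A + \d_(2^-1%R : mR) A - leb (A `&` `[0%R, 1%R[%classic))%E.
Proof. by []. Qed.

Lemma conv_charge_carried : carried_01 conv_charge.
Proof.
move=> A mA A0; rewrite conv_chargeE A0 measure0 sube0 !diracE.
have nA (x : R) : 0 <= x < 1 -> x \notin A.
  move=> x01; apply/negP => /set_mem Ax.
  suff : (A `&` `[0, 1[%classic) x by rewrite A0.
  by split => //=; rewrite in_itv.
rewrite (negbTE (nA 0 _)) ?lexx ?ltr01// (negbTE (nA 2^-1 _)) ?adde0//.
by apply/andP; split; lra.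
Qed.

Let clamp x : R := Num.max 0 (Num.min x 1).

Let clamp01 x : `[0, 1]%classic (clamp x).
Proof. by rewrite /= in_itv/= /clamp le_max lexx ge_max ler01 ge_min lexx orbT. Qed.

Let clamp_id x : 0 <= x <= 1 -> clamp x = x.
Proof. by move=> /andP[x0 x1]; rewrite /clamp min_l// max_r. Qed.

Let continuous_clamp : continuous clamp.
Proof.
have cmin : continuous (fun x : R => Num.min x 1).
  by move=> x; apply: continuous_min; [exact: cvg_id|exact: cvg_cst].
move=> x; apply: (@continuous_max _ _ (fun=> 0) (fun x : R => Num.min x 1)).
  exact: cvg_cst.
exact: cmin.
Qed.

(** Composition with the retraction onto [0, 1]; elements of C_0 come with arbitrary values
    outside. *)
Lemma continuous_extension01 g : {within `[0, 1], continuous g} ->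
  exists2 h : R -> R, continuous h & forall x, 0 <= x <= 1 -> h x = g x.
Proof.
move=> cg; exists (g \o clamp) => [x|x x01]; last by rewrite /= clamp_id.
have cgx : g @ within `[0, 1] (nbhs (clamp x)) --> g (clamp x).
  by move/subspace_continuousP : cg; apply; exact: clamp01.
move=> P hP.
have nP : nbhs x (clamp @^-1` [set y | `[0, 1]%classic y -> P (g y)]).
  exact: continuous_clamp (cgx P hP).
by apply: filterS nP => t /=; apply; exact: clamp01.
Qed.

(** The substitution t -> x - t, which turns the Lebesgue part of the convolution into V. *)
Lemma volterra_reflect h x : continuous h -> 0 <= x ->
  \int[leb]_(t in `[0, x]) h (x - t) = volterra h x.
Proof.
move=> ch x0; rewrite /volterra /Rintegral; congr fine.
pose F t := x - t.
have F' : derive1 F = cst (-1).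
  by apply/funext => t; rewrite derive1E /F deriveB// derive_cst derive_id sub0r.
have cF : continuous F.
  by move=> t; apply: cvgB; [exact: cvg_cst|exact: cvg_id].
have := @integration_by_substitution_decreasing R F h 0 x x0.
rewrite /F subrr subr0 -/F F' => ->.
- by apply: eq_integral => t _; rewrite !fctE opprK mulr1.
- by move=> s t _ _ st; rewrite ltrD2l ltrN2.
- by move=> t _; exact: cvg_cst.
- exact: is_cvg_cst.
- exact: is_cvg_cst.
- split => [t _| |]; first exact: derivableB.
    by apply: cvg_at_right_filter; exact: cF.
  by apply: cvg_at_left_filter; exact: cF.
- exact: continuous_subspaceT.
Qed.

(** The positive set of a Hahn decomposition of [conv_charge]: it carries both point masses and is
    Lebesgue null. *)
Let atoms : set mR := [set (0 : mR)] `|` [set (2^-1 : mR)].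

Let lebesgue_atoms : mfrestr m01 fin01 atoms = 0%E.
Proof.
rewrite /mfrestr /mrestr; apply: (@subset_measure0 _ _ _ leb _ atoms).
- by apply: measurableI => //; exact: measurableU.
- exact: measurableU.
- exact: subIsetl.
- transitivity (leb [set 0]); last exact: lebesgue_measure_set1.
  by apply: measureU0 => //; exact: lebesgue_measure_set1.
Qed.

Let diracC (a : mR) : atoms a -> \d_a (~` atoms) = 0%E :> \bar R.
Proof. by move=> aA; rewrite diracE memNset//; apply. Qed.

Lemma charge_integral_conv g x : {within `[0, 1], continuous g} -> 0 <= x <= 1 ->
  charge_integral conv_charge `[0, 1[%classic
    (fun t => if t <= x then g (x - t) else 0) = tconv g x.
Proof.
move=> cg x01; have /andP[x0 x1] := x01.
(* The extension h makes the integrand measurable on the line; the integral does not change, since x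
   - t stays in [0, 1]. *)
have [h ch hg] := continuous_extension01 cg.
rewrite -(eq_tconv01 hg x01).
pose F (t : R) : R := if t <= x then h (x - t) else 0.
rewrite (@charge_integralE _ (measure_add (dirac (0 : mR)) (dirac (2^-1 : mR)))
  (mfrestr m01 fin01) atoms); last 4 first.
- exact: measurableU.
- apply: etrans (measure_addE _ _ _) _.
  by apply: etrans (f_equal2 _ (diracC (or_introl erefl))
    (diracC (or_intror erefl))) (adde0 _).
- exact: lebesgue_atoms.
- move=> A mA; rewrite conv_chargeE; congr (_ - _)%E.
  by apply: esym; exact: measure_addE.
have FE (m : {measure set mR -> \bar R}) :
    Rintegral m `[0, 1[%classic (fun t => if t <= x then g (x - t) else 0) =
    Rintegral m `[0, 1[%classic F.
  apply: eq_Rintegral => t /set_mem/=; rewrite in_itv/= => /andP[t0 t1].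
  by rewrite /F; case: ifP => // tx; rewrite hg// subr_ge0 tx/=; lra.
rewrite !FE.
have mF : measurable_fun [set: mR] (EFin \o F).
  apply/measurable_EFinP; apply: measurable_fun_ifT => //.
    exact: measurable_fun_ler.
  apply: continuous_measurable_fun => t.
  apply: (@continuous_comp _ _ _ (fun t => x - t) h); last exact: ch.
  by apply: cvgB; [exact: cvg_cst|exact: cvg_id].
have mF01 : measurable_fun (`[0, 1[%classic : set mR) (EFin \o F).
  exact: measurable_funTS.
have dirac_int (a : mR) : (dirac a).-integrable (`[0%R, 1%R[%classic : set mR) (EFin \o F).
  apply/integrableP; split => //; rewrite integral_dirac//; last first.
    exact: measurableT_comp.
  by rewrite diracE; case: (_ \in _); rewrite ?mul1e ?mul0e ?ltry.
have -> : Rintegral (measure_add (dirac (0 : mR)) (dirac (2^-1 : mR))) `[0, 1[%classic F =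
    F 0 + F 2^-1.
  have dI (a : mR) : 0 <= a < 1 ->
      (\int[dirac a]_(t in `[0%R, 1%R[%classic) (F t)%:E = (F a)%:E)%E.
    move=> a01; rewrite integral_dirac//.
    by rewrite diracE mem_set ?mul1e//= in_itv.
  rewrite -[RHS]/(fine ((F 0)%:E + (F 2^-1)%:E)%E); congr fine.
  apply: etrans (integral_measure_add m01 (dirac_int 0) (dirac_int 2^-1)) _.
  by apply: f_equal2; apply: dI; apply/andP; split; lra.
have -> : Rintegral (mfrestr m01 fin01) `[0, 1[%classic F = volterra h x.
  rewrite -volterra_reflect//.
  have iF : leb.-integrable `[0, x] (EFin \o (fun t => h (x - t))).
    apply: continuous_integrable_itv => t.
    apply: (@continuous_comp _ _ _ (fun t => x - t) h); last exact: ch.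
    by apply: cvgB; [exact: cvg_cst|exact: cvg_id].
  have sE : `[0, 1]%classic `&` `]-oo, x]%classic = `[0, x]%classic :> set R.
    apply/seteqP; split => t /=; rewrite !in_itv/=; first by move=> [/andP[-> _] ->].
    by move=> /andP[t0 tx]; rewrite t0 tx (le_trans tx).
  have FpE : F = (fun t => h (x - t)) \_ `]-oo, x]%classic.
    by apply/funext => t; rewrite /F patchE mem_setE in_itv/=.
  transitivity (\int[leb]_(t in `[0, 1[) F t).
    rewrite /Rintegral; congr fine; apply: eq_measure_integral => A mA A01.
    exact: (congr1 (fun B : set mR => leb B) (setIidl A01)).
  have iF01 : leb.-integrable `[0, 1] (EFin \o F).
    rewrite FpE -restrict_EFin; apply/integrable_restrict => //.
    by rewrite sE.
  (* For x = 1 the point t = 1 belongs to [0, x] but not to [0, 1); it is a null set. *)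
  rewrite Rintegral_itv_bndo_bndc; last first.
    by apply: integrableS iF01 => //; exact: subset_itv_co_cc.
  by rewrite FpE -Rintegral_mkcondr sE.
by rewrite /tconv /idVolterra /F x0 subr0 addrAC.
Qed.

End ChargeIntegral.


(** * L^p norms *)

Section Lnorm01.
Variable R : realType.
Local Notation leb := (@lebesgue_measure R).
Local Notation mR := (measurableTypeR R).
Local Notation I := (`[0, 1]%classic : set R).
Local Open Scope ereal_scope.
Implicit Types (w : mR -> R) (p : \bar R).

Lemma lebesgue_measure_shift (a : R) (A : set mR) : measurable A ->
  pushforward leb (fun x : mR => (x - a)%R : mR) A = leb A.
Proof.
move=> mA; apply/esym/lebesgue_measure_unique => //=.
  exact: measurable_funB.
move=> _ _ [[b c]] _ <-.
rewrite /pushforward (_ : _ @^-1` _ = `](b + a)%R, (c + a)%R]%classic).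
  rewrite !lebesgue_measure_itv/= !lte_fin ltrD2r.
  by case: ifP => // _; rewrite -!EFinB; congr EFin; lra.
by apply/seteqP; split => x /=; rewrite !in_itv/= ltrBrDr lerBlDr.
Qed.

Lemma lebesgue01 : leb `[0%R, 1%R] = 1.
Proof. by rewrite lebesgue_measure_itv/= lte_fin ltr01 sube0. Qed.

Lemma lebesgueT_gt0 : 0 < leb [set: R].
Proof.
apply: (@lt_le_trans _ _ (leb `[0%R, 1%R])); first by rewrite lebesgue01.
by apply: le_measure; rewrite ?inE.
Qed.

Lemma le_Lnorm w1 w2 p : 1 <= p ->
  measurable_fun [set: mR] w1 -> measurable_fun [set: mR] w2 ->
  (forall x, `|w1 x| <= `|w2 x|)%R ->
  Lnorm leb p (EFin \o w1) <= Lnorm leb p (EFin \o w2).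
Proof.
case: p => [r|_|//]; last first.
  move=> _ _ w12; rewrite unlock lebesgueT_gt0.
  by apply: le_ess_sup; apply: nearW => x /=; rewrite lee_fin.
rewrite lee_fin => r1 m1 m2 w12; have r0 : (0 < r)%R by rewrite (lt_le_trans ltr01).
have mw w : measurable_fun [set: mR] w ->
    measurable_fun [set: mR] (fun x => `|(w x)%:E| `^ r).
  move=> mw; apply: (measurableT_comp (measurable_poweR _)).
  by apply: measurableT_comp => //; exact/measurable_EFinP.
rewrite unlock; apply: gt0_ler_poweR; rewrite ?in_itv/= ?leey ?andbT.
- by rewrite invr_ge0 ltW.
- by apply: integral_ge0 => x _; rewrite lee_fin powR_ge0.
- by apply: integral_ge0 => x _; rewrite lee_fin powR_ge0.
apply: ge0_le_integral => //.
- exact: mw.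
- exact: mw.
- move=> x _; rewrite lee_fin; apply: ge0_ler_powR; rewrite ?nnegrE//.
  exact: ltW.
Qed.

Lemma ae_eq_Lnorm w1 w2 p : 1 <= p ->
  measurable_fun [set: mR] w1 -> measurable_fun [set: mR] w2 ->
  {ae leb, forall x, w1 x = w2 x} ->
  Lnorm leb p (EFin \o w1) = Lnorm leb p (EFin \o w2).
Proof.
case: p => [r|_|//]; last first.
  move=> _ _ w12; rewrite unlock lebesgueT_gt0.
  by apply: eq_ess_sup; apply: filterS w12 => x /= ->.
move=> _ m1 m2 w12; rewrite unlock; congr (_ `^ _).
have mw w : measurable_fun [set: mR] w ->
    measurable_fun [set: mR] (fun x => `|(w x)%:E| `^ r).
  move=> mw; apply: (measurableT_comp (measurable_poweR _)).
  by apply: measurableT_comp => //; exact/measurable_EFinP.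
apply: ae_eq_integral => //.
- exact: mw.
- exact: mw.
- by apply: filterS w12 => x /= ->.
Qed.

Lemma Lnorm_shift (a : R) w p : 1 <= p -> measurable_fun [set: mR] w ->
  Lnorm leb p (EFin \o (fun x : mR => w (x - a)%R)) <= Lnorm leb p (EFin \o w).
Proof.
have ms : measurable_fun [set: mR] (fun x : mR => (x - a)%R : mR).
  by apply: measurable_funB.
case: p => [r|_|//]; last first.
  move=> mw; rewrite unlock lebesgueT_gt0; apply/ess_supP.
  have [N [mN N0 wN]] := @ess_sup_ge _ _ _ leb (abse \o (EFin \o w)).
  exists ((fun x : mR => (x - a)%R : mR) @^-1` N); split.
  - by rewrite -[X in measurable X]setTI; exact: ms.
  - rewrite -[LHS]/(pushforward leb (fun x : mR => (x - a)%R : mR) N).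
    by rewrite lebesgue_measure_shift.
  - by move=> x /= wx; apply: wN.
move=> _ mw; rewrite unlock.
suff -> : \int[leb]_x (`|(EFin \o (fun x : mR => w (x - a)%R)) x| `^ r) =
  \int[leb]_x (`|(EFin \o w) x| `^ r) by [].
have mw' : measurable_fun [set: mR] (fun x => `|(EFin \o w) x| `^ r).
  apply: (measurableT_comp (measurable_poweR _)).
  by apply: measurableT_comp => //; exact/measurable_EFinP.
transitivity (\int[pushforward leb (fun x : mR => (x - a)%R : mR)]_x (`|(EFin \o w) x| `^ r)).
  rewrite ge0_integral_pushforward//.
  by move=> x _; exact: poweR_ge0.
by apply: eq_measure_integral => A mA _; exact: lebesgue_measure_shift.
Qed.

Lemma Lnorm_cst01 (c : R) p : 1 <= p -> (0 <= c)%R ->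
  Lnorm leb p (EFin \o (cst c \_ I)) <= c%:E.
Proof.
case: p => [r|_|//]; last first.
  move=> c0; rewrite unlock lebesgueT_gt0; apply/ess_supP/nearW => x /=.
  by rewrite lee_fin patchE; case: ifP => _; rewrite ?normr0// ger0_norm.
rewrite lee_fin => r1 c0; have r0 : (0 < r)%R by rewrite (lt_le_trans ltr01).
rewrite unlock (_ : \int[leb]_x _ = \int[leb]_(x in I) (c `^ r)%:E).
  rewrite integral_cst//= lebesgue01 mule1 /=.
  by rewrite -powRrM divff ?gt_eqF// powRr1.
rewrite [RHS]integral_mkcond; apply: eq_integral => x _ /=.
rewrite !patchE; case: ifP => _ /=; first by rewrite ger0_norm.
by rewrite normr0 powR0// gt_eqF.
Qed.

(** Hoelder's inequality against the indicator of [0, 1], whose conjugate norm is at most 1. The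
    case p = 1 is set apart because q would be the inverse of 0. *)
Lemma Lnorm1_le w p : 1 <= p -> measurable_fun [set: mR] w ->
  (forall x, ~ I x -> w x = 0%R) ->
  Lnorm leb 1 (EFin \o w) <= Lnorm leb p (EFin \o w).
Proof.
move=> + mw w0; case: p => [r|_|//]; last first.
  rewrite Lnorm1 unlock lebesgueT_gt0.
  set s := ess_sup _ _.
  have s0 : 0 <= s by apply: ess_sup_gee; [exact: lebesgueT_gt0|by apply: nearW => x /=].
  rewrite (_ : \int[leb]_x _ = \int[leb]_(x in I) `|(w x)%:E|).
    apply: (@le_trans _ _ (\int[leb]_(x in I) s)); last first.
      by rewrite integral_cst//= lebesgue01 mule1.
    apply: ae_ge0_le_integral => //.
    - by apply: measurableT_comp => //; apply/measurable_EFinP; exact: measurable_funTS.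
    - have := @ess_sup_ge _ _ _ leb (abse \o (EFin \o w)).
      by apply: filterS => x + _.
  rewrite [RHS]integral_mkcond; apply: eq_integral => x _ /=.
  rewrite patchE; case: ifPn => //; rewrite notin_setE => /w0 ->.
  by rewrite normr0.
rewrite lee_fin le_eqVlt => /predU1P[<-//|r1].
have r0 : (0 < r)%R by rewrite (lt_trans ltr01).
pose q := ((1 - r^-1)^-1)%R.
have q0 : (0 < q)%R by rewrite invr_gt0 subr_gt0 invf_lt1.
have rq : (r^-1 + q^-1 = 1)%R by rewrite invrK addrC subrK.
pose i : mR -> R := (cst 1%R : R -> R) \_ I.
have mi : measurable_fun [set: mR] i.
  apply/(@measurable_restrictT _ _ mR R I (fun=> 1%R) (measurable_itv _)).
  exact: measurable_cst.
have := @hoelder _ mR R leb w i r q mw mi r0 q0 rq.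
rewrite (_ : (w \* i)%R = w); last first.
  apply/funext => x /=; rewrite /i patchE; case: ifPn; first by rewrite mulr1.
  by rewrite notin_setE => /w0 ->; rewrite mul0r.
move=> /le_trans; apply; rewrite -[leRHS]mule1; apply: lee_wpmul2l.
  exact: Lnorm_ge0.
apply: Lnorm_cst01 => //; rewrite lee_fin /q invr_ge1 ?unitfE ?gt_eqF ?subr_gt0 ?invf_lt1//.
by rewrite gerBl invr_ge0 ltW.
Qed.

End Lnorm01.


(** * Real and complex scalars *)

Section Scalars.
Variable R : realType.
Implicit Types (k : scalar_kind) (u v : R -> R).
Local Notation leb := (@lebesgue_measure R).
Local Notation mR := (measurableTypeR R).
Local Notation I := (`[0, 1]%classic : set R).

(** Coordinates shared by both kinds of scalars, so that the analysis is done once, for real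
    functions. *)
Definition kre k : scalar_field R k -> R :=
  match k with RealScalars => id | ComplexScalars => @complex.Re R end.

Definition kim k : scalar_field R k -> R :=
  match k with RealScalars => fun=> 0 | ComplexScalars => @complex.Im R end.

(* For real scalars the second argument is ignored. *)
Definition kmk k (a b : R) : scalar_field R k :=
  match k with RealScalars => a | ComplexScalars => Complex a b end.

Lemma kre_mk k a b : kre (kmk k a b) = a.
Proof. by case: k. Qed.

Lemma kscalarP k (z w : scalar_field R k) :
  kre z = kre w -> kim z = kim w -> z = w.
Proof. by case: k z w => // -[a b] [c d] /= -> ->. Qed.

(** Associated as in [tconv_lin], so that linearity over complex scalars reduces to real
    combinations of three functions. *)
Lemma kre_lin k (a z w : scalar_field R k) :
  kre (a * z + w) = kre a * kre z + (- kim a * kim z + kre w).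
Proof.
case: k a z w => [a z w|[a a'] [z z'] [w w']] /=; first by rewrite oppr0 mul0r add0r.
by rewrite addrA mulNr.
Qed.

Lemma kim_lin k (a z w : scalar_field R k) :
  kim (a * z + w) = kre a * kim z + (kim a * kre z + kim w).
Proof.
case: k a z w => [a z w|[a a'] [z z'] [w w']] /=; first by rewrite mulr0 mul0r !addr0.
by rewrite addrA.
Qed.

Lemma modulus_ge0 k (z : scalar_field R k) : 0 <= modulus z.
Proof. by case: k z => [z|z] /=. Qed.

Lemma modulus_le k (z : scalar_field R k) : modulus z <= `|kre z| + `|kim z|.
Proof.
case: k z => [z|[a b]] /=; first by rewrite normr0 addr0.
rewrite -[leRHS]ger0_norm ?addr_ge0// -sqrtr_sqr ler_wsqrtr//.
rewrite sqrrD !real_normK ?num_real// lerD2r lerDl.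
by rewrite mulrn_wge0// mulr_ge0.
Qed.

Lemma kre_le k (z : scalar_field R k) : `|kre z| <= modulus z.
Proof.
case: k z => [z|[a b]] //=.
by rewrite -sqrtr_sqr ler_wsqrtr// lerDl sqr_ge0.
Qed.

Lemma kim_le k (z : scalar_field R k) : `|kim z| <= modulus z.
Proof.
case: k z => [z|[a b]] /=; first by rewrite normr0.
by rewrite -sqrtr_sqr ler_wsqrtr// lerDr sqr_ge0.
Qed.

Lemma modulus_eq0 k (z : scalar_field R k) : modulus z = 0 -> z = 0.
Proof.
move=> z0; have := kre_le z; have := kim_le z; rewrite z0 !normr_le0.
move=> /eqP zi /eqP zr; apply: kscalarP; rewrite ?zi ?zr; by case: (k).
Qed.

Lemma modulus0 k : modulus (0 : scalar_field R k) = 0.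
Proof.
case: k => /=; first by rewrite normr0.
by rewrite expr0n addr0 sqrtr0.
Qed.

Lemma modulus_mk0 k a : modulus (kmk k a 0) = `|a|.
Proof. by case: k => //=; rewrite expr0n addr0 sqrtr_sqr. Qed.

Lemma measurable_kre k (g : R -> scalar_field R k) : kmeasurable_01 g ->
  measurable_fun (I : set mR) (fun x => kre (g x) : mR).
Proof. by case: k g => [g|g []]. Qed.

Lemma measurable_kim k (g : R -> scalar_field R k) : kmeasurable_01 g ->
  measurable_fun (I : set mR) (fun x => kim (g x) : mR).
Proof. by case: k g => [g _|g []] //; exact: measurable_cst. Qed.

Lemma measurable_kmk k (g : R -> scalar_field R k) :
  measurable_fun (I : set mR) (fun x => kre (g x) : mR) ->
  measurable_fun (I : set mR) (fun x => kim (g x) : mR) -> kmeasurable_01 g.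
Proof. by case: k g. Qed.

Lemma measurable_modulus k (g : R -> scalar_field R k) : kmeasurable_01 g ->
  measurable_fun (I : set mR) (fun x => modulus (g x) : mR).
Proof.
case: k g => [g mg|g [mr mi]] /=.
  exact: measurableT_comp.
apply: (measurableT_comp (f := @Num.sqrt R : mR -> mR)).
  by apply: continuous_measurable_fun; exact: sqrt_continuous.
by apply: measurable_funD; exact: measurable_funX.
Qed.

(** The norm of [scalar_field R k] is valued in that field; this is the bridge from its topology to
    the real [modulus]. *)
Lemma norm_kscalar k (z : scalar_field R k) : `|z| = kmk k (modulus z) 0.
Proof. by case: k z => // -[a b]. Qed.

Lemma ltr_kmk0 k a b : (kmk k a 0 < kmk k b 0) = (a < b).
Proof. by case: k => //=; rewrite ltcE/= eqxx. Qed.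

Lemma kmk0_gt0 k (e : scalar_field R k) : 0 < e ->
  exists2 a, 0 < a & e = kmk k a 0.
Proof.
case: k e => [e e0|[e e']]; first by exists e.
by rewrite ltcE/= => /andP[/eqP <- e0]; exists e.
Qed.

Lemma kreB k (z w : scalar_field R k) : kre (z - w) = kre z - kre w.
Proof. by case: k z w => // -[a b] [c d]. Qed.

Lemma kimB k (z w : scalar_field R k) : kim (z - w) = kim z - kim w.
Proof. by case: k z w => [z w|[a b] [c d]] //=; rewrite subrr. Qed.

Lemma near_modulus k (z : scalar_field R k) (e : R) : 0 < e ->
  \forall w \near z, modulus (z - w) < e.
Proof.
move=> e0; have e0' : 0 < kmk k e 0.
  by have := ltr_kmk0 k 0 e; rewrite e0; case: (k).
apply: filterS (nbhsx_ballx z _ e0') => w.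
by rewrite -ball_normE/= norm_kscalar ltr_kmk0.
Qed.

Lemma continuous_kre k : continuous (@kre k).
Proof.
move=> z; have Fz : Filter (nbhs z) := nbhs_filter z.
apply/(@cvgrPdist_lt _ _ _ _ Fz) => e e0.
apply: filterS (near_modulus z e0) => w.
by apply: le_lt_trans; rewrite -kreB kre_le.
Qed.

Lemma continuous_kim k : continuous (@kim k).
Proof.
move=> z; have Fz : Filter (nbhs z) := nbhs_filter z.
apply/(@cvgrPdist_lt _ _ _ _ Fz) => e e0.
apply: filterS (near_modulus z e0) => w.
by apply: le_lt_trans; rewrite -kimB kim_le.
Qed.

Lemma continuous_kmk0 k : continuous (fun a => kmk k a 0).
Proof.
move=> a; have Fa : Filter (nbhs a) := nbhs_filter a.
apply/(@cvgrPdist_lt _ _ _ _ Fa) => e /kmk0_gt0[d d0 ->].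
near=> b.
have -> : kmk k a 0 - kmk k b 0 = kmk k (a - b) 0.
  by apply: kscalarP; rewrite ?kreB ?kimB ?kre_mk//; case: (k) => //=; rewrite subrr.
rewrite norm_kscalar ltr_kmk0 modulus_mk0.
by near: b; exact: cvgr_dist_lt.
Unshelve. all: end_near. Qed.

Lemma within_continuous_comp (T U : topologicalType) (A : set R)
    (f : R -> T) (h : T -> U) :
  {within A, continuous f} -> continuous h -> {within A, continuous (h \o f)}.
Proof.
move=> cf ch x.
exact: (@continuous_comp (subspace A) T U f h x (cf x) (ch (f x))).
Qed.

Lemma C0_01_mk k u : causal u -> C0_01 (fun x => kmk k (u x) 0).
Proof.
move=> [cu u0]; split; last first.
  by rewrite u0//; case: (k).
apply: (@within_continuous_comp _ _ _ u (fun a => kmk k a 0)).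
  exact: continuous_subspaceT.
exact: continuous_kmk0.
Qed.

Definition conv_kmeasure k : kmeasure R k :=
  match k with
  | RealScalars => conv_charge R
  | ComplexScalars => (conv_charge R, (czero : {charge set mR -> \bar R}))
  end.

Lemma conv_kmeasure_01 k : measure_01 (conv_kmeasure k).
Proof.
case: k => /=; first exact: conv_charge_carried.
by split; [exact: conv_charge_carried|].
Qed.

(** T acts on each coordinate separately because the measure is real. The formula makes sense for
    every representative and gives the operator on all L^p at once. *)
Definition ktconv k (g : R -> scalar_field R k) (x : R) : scalar_field R k :=
  kmk k (tconv (fun t => kre (g t)) x) (tconv (fun t => kim (g t)) x).

Lemma tconv0 : tconv (fun=> 0 : R) = fun=> 0.
Proof.
apply/funext => x; rewrite /tconv /idVolterra /volterra Rintegral_cst//=.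
by rewrite mul0r subrr add0r; case: ifP.
Qed.

Lemma kre_ktconv k (g : R -> scalar_field R k) x :
  kre (ktconv g x) = tconv (fun t => kre (g t)) x.
Proof. by case: k g. Qed.

Lemma kim_ktconv k (g : R -> scalar_field R k) x :
  kim (ktconv g x) = tconv (fun t => kim (g t)) x.
Proof. by case: k g => //= g; rewrite tconv0. Qed.

Lemma truncated_convolutionE k (g : R -> scalar_field R k) x :
  C0_01 g -> 0 <= x <= 1 ->
  truncated_convolution (conv_kmeasure k) g x = ktconv g x.
Proof.
move=> [cg g0] x01.
have cr : {within I, continuous (fun t => kre (g t))}.
  by apply: within_continuous_comp cg _; exact: continuous_kre.
have ci : {within I, continuous (fun t => kim (g t))}.
  by apply: within_continuous_comp cg _; exact: continuous_kim.
case: k g {cg g0} cr ci => g cr ci.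
  exact: charge_integral_conv.
rewrite /truncated_convolution /kintegral /ktconv /=.
rewrite !charge_integral0 subr0 addr0 /=.
by congr Complex; rewrite -charge_integral_conv//; congr charge_integral;
  apply/funext => t; case: ifP.
Qed.

Lemma eq_truncated_convolution k (mu : kmeasure R k) (g h : R -> scalar_field R k) x :
  (forall t, 0 <= t <= 1 -> g t = h t) -> 0 <= x <= 1 ->
  truncated_convolution mu g x = truncated_convolution mu h x.
Proof.
move=> gh x01.
have E t : `[0, 1[%classic t ->
    (if t <= x then g (x - t) else 0) = (if t <= x then h (x - t) else 0).
  rewrite /= in_itv/= => /andP[t0 t1]; case: ifP => // tx; rewrite gh//.
  by move/andP: x01 => [x0 x1]; rewrite subr_ge0 tx/=; lra.
case: k mu g h {gh} E => mu g h E; rewrite /truncated_convolution /kintegral.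
  rewrite /charge_integral; congr (_ - _); apply: eq_Rintegral => t /set_mem;
    exact: E.
by congr (Complex (_ - _) (_ + _)); rewrite /charge_integral; congr (_ - _);
  apply: eq_Rintegral => t /set_mem/E ->.
Qed.

Lemma iter_truncated_convolutionE k n u x : causal u -> 0 <= x <= 1 ->
  iter n (truncated_convolution (conv_kmeasure k)) (fun t => kmk k (u t) 0) x =
  kmk k (iter n tconv u x) 0.
Proof.
move=> cu; elim: n x => //= n IH x x01.
rewrite (eq_truncated_convolution _ IH x01).
have cn := causal_iter_tconv n cu.
rewrite truncated_convolutionE//; last exact: C0_01_mk.
case: (k) => //=; by rewrite tconv0.
Qed.

End Scalars.


(** * The operator on L^p *)

Section LpOperator.
Variables (R : realType) (k : scalar_kind).
Implicit Types (u v w : R -> R) (g h : R -> scalar_field R k) (p : \bar R).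
Local Notation leb := (@lebesgue_measure R).
Local Notation mR := (measurableTypeR R).
Local Notation I := (`[0, 1]%classic : set R).

Let mI : measurable (I : set mR).
Proof. exact: measurable_itv. Qed.

Lemma measurable_modulus_restrict g : kmeasurable_01 g ->
  measurable_fun [set: mR] ((fun x => modulus (g x)) \_ I : mR -> R).
Proof.
move=> mg; apply/(@measurable_restrictT _ _ mR R I _ mI).
exact: measurable_modulus.
Qed.

Lemma Lp_norm_ge0 p g : (0 <= Lp_norm p g)%E.
Proof. exact: Lnorm_ge0. Qed.

Lemma Lp_norm1_le p g : (1 <= p)%E -> kmeasurable_01 g ->
  (Lp_norm 1 g <= Lp_norm p g)%E.
Proof.
move=> p1 mg; apply: Lnorm1_le => //; first exact: measurable_modulus_restrict.
by move=> x xI; rewrite patchE memNset.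
Qed.

Lemma Lp_norm_le_cst p g (c : R) : (1 <= p)%E -> kmeasurable_01 g ->
  (forall x, 0 <= x <= 1 -> modulus (g x) <= c) -> (Lp_norm p g <= c%:E)%E.
Proof.
move=> p1 mg gc.
have c0 : 0 <= c by apply: le_trans (modulus_ge0 (g 0)) (gc 0 _); rewrite lexx ler01.
apply: le_trans (Lnorm_cst01 p1 c0); apply: le_Lnorm => //.
- exact: measurable_modulus_restrict.
- apply/(@measurable_restrictT _ _ mR R I (cst c) mI); exact: measurable_cst.
- move=> x; rewrite !patchE; case: ifPn => // /set_mem xI.
  by rewrite !ger0_norm ?modulus_ge0// gc.
Qed.

Lemma ae_eq_Lp_norm p g h : (1 <= p)%E -> kmeasurable_01 g -> kmeasurable_01 h ->
  ae_eq_01 g h -> Lp_norm p g = Lp_norm p h.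
Proof.
move=> p1 mg mh gh; apply: ae_eq_Lnorm => //; [exact: measurable_modulus_restrict..|].
move: gh; apply: (@filterS _ _ (ae_filter_ringOfSetsType leb)) => x gh.
rewrite !patchE; case: ifPn => // /set_mem xI.
by rewrite gh.
Qed.

Lemma Lp_norm0_ae p g : (1 <= p)%E -> kmeasurable_01 g ->
  Lp_norm p g = 0%E -> ae_eq_01 g (fun=> 0).
Proof.
move=> p1 mg g0; have mg' := measurable_modulus_restrict mg.
have := @Lnorm_eq0_eq0 _ mR R leb (EFin \o ((fun x => modulus (g x)) \_ I)) p.
move=> /(_ _ _ g0) => H.
have {}H : (EFin \o ((fun x => modulus (g x)) \_ I : mR -> R)) = \0%E %[ae leb].
  by apply: H; [exact/measurable_EFinP|exact: lt_le_trans p1].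
move: H; apply: (@filterS _ _ (ae_filter_ringOfSetsType leb)) => x /(_ Logic.I) /= + xI.
rewrite patchE mem_set// => -[].
exact: modulus_eq0.
Qed.

Lemma in_Lp_integrable p g : (1 <= p)%E -> in_Lp p g ->
  leb.-integrable I (EFin \o (fun x => modulus (g x))).
Proof.
move=> p1 [mg g_lty]; apply/integrableP; split.
  by apply/measurable_EFinP; exact: measurable_modulus.
apply: le_lt_trans (le_lt_trans (Lp_norm1_le p1 mg) g_lty).
rewrite /Lp_norm Lnorm1 le_eqVlt; apply/orP; left; apply/eqP.
rewrite [LHS]integral_mkcond; apply: eq_integral => x _ /=; rewrite !patchE; case: ifP => //=.
by rewrite normr0.
Qed.

Lemma Rintegral_modulus g : leb.-integrable I (EFin \o (fun x => modulus (g x))) ->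
  Lp_norm 1 g = (\int[leb]_(x in I) modulus (g x))%:E.
Proof.
move=> ig; rewrite /Rintegral fineK; last exact: integrable_fin_num.
rewrite /Lp_norm Lnorm1 [RHS]integral_mkcond.
apply: eq_integral => x _ /=; rewrite !patchE; case: ifP => //= _.
  by rewrite ger0_norm// modulus_ge0.
by rewrite normr0.
Qed.

Lemma integrable_kre p g : (1 <= p)%E -> in_Lp p g ->
  leb.-integrable I (EFin \o (fun x => kre (g x))).
Proof.
move=> p1 gp; apply: (le_integrable mI _ _ (in_Lp_integrable p1 gp)).
  by apply/measurable_EFinP; apply: measurable_kre; exact: gp.1.
by move=> x _; rewrite lee_fin (ger0_norm (modulus_ge0 _)) kre_le.
Qed.

Lemma integrable_kim p g : (1 <= p)%E -> in_Lp p g ->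
  leb.-integrable I (EFin \o (fun x => kim (g x))).
Proof.
move=> p1 gp; apply: (le_integrable mI _ _ (in_Lp_integrable p1 gp)).
  by apply/measurable_EFinP; apply: measurable_kim; exact: gp.1.
by move=> x _; rewrite lee_fin (ger0_norm (modulus_ge0 _)) kim_le.
Qed.

Let sub0x x : 0 <= x <= 1 -> `[0, x]%classic `<=` I.
Proof.
move=> /andP[_ x1] t /=; rewrite !in_itv/= => /andP[-> tx].
exact: le_trans tx x1.
Qed.

Let integrable0x u x : leb.-integrable I (EFin \o u) -> 0 <= x <= 1 ->
  leb.-integrable `[0, x] (EFin \o u).
Proof. by move=> iu x01; apply: integrableS iu => //; exact: sub0x. Qed.

Lemma tconv_lin u v w (a b : R) x : 0 <= x <= 1 ->
  leb.-integrable I (EFin \o u) -> leb.-integrable I (EFin \o v) ->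
  leb.-integrable I (EFin \o w) ->
  tconv (fun t => a * u t + (b * v t + w t)) x =
  a * tconv u x + (b * tconv v x + tconv w x).
Proof.
move=> x01 /integrable0x/(_ x01) iu /integrable0x/(_ x01) iv /integrable0x/(_ x01) iw.
have m0x : measurable (`[0, x]%classic : set mR) by exact: measurable_itv.
have iZ (c : R) (z : R -> R) : leb.-integrable `[0, x] (EFin \o z) ->
    leb.-integrable `[0, x] (EFin \o (fun t => c * z t)).
  by move=> iz; exact: (@integrableZl _ mR R leb _ m0x c _ iz).
have iD (z z' : R -> R) : leb.-integrable `[0, x] (EFin \o z) ->
    leb.-integrable `[0, x] (EFin \o z') ->
    leb.-integrable `[0, x] (EFin \o (fun t => z t + z' t)).
  by move=> iz iz'; exact: (@integrableD _ mR R leb _ m0x _ _ iz iz').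
rewrite /tconv /idVolterra /volterra RintegralD ?RintegralD ?RintegralZl//.
- by case: ifP => _; ring.
- exact: iZ.
- exact: iZ.
- by apply: iD => //; exact: iZ.
Qed.

Lemma measurable_tconv u : leb.-integrable I (EFin \o u) ->
  measurable_fun (I : set mR) (tconv u : mR -> mR).
Proof.
move=> iu; have mu : measurable_fun (I : set mR) (u : mR -> mR).
  by apply/measurable_EFinP; case/integrableP : iu.
apply: measurable_funD.
  apply: measurable_funB => //.
  apply: subspace_continuous_measurable_fun => //.
  exact: (parameterized_integral_continuous ler01 iu).
have mw : measurable_fun [set: mR] (u \_ I : mR -> mR).
  exact/(@measurable_restrictT _ _ mR mR I u mI).
apply: (@eq_measurable_fun _ _ mR mR I (fun x => (u \_ I) (x - 2^-1))).
  move=> x /set_mem/=; rewrite in_itv/= => /andP[x0 x1].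
  rewrite patchE mem_setE in_itv/= subr_ge0; case: (leP 2^-1 x) => xh //=.
  by rewrite ifT//; have := half01 R; lra.
apply: measurable_funTS; apply: (measurableT_comp mw).
exact: measurable_funB.
Qed.

Lemma norm_volterra_integral_le u v x : 0 <= x <= 1 ->
  leb.-integrable I (EFin \o u) -> leb.-integrable I (EFin \o v) ->
  (forall t, `|u t| <= v t) -> `|volterra u x| <= \int[leb]_(t in I) v t.
Proof.
move=> x01 iu iv uv.
have iu' := integrable0x iu x01; have iv' := integrable0x iv x01.
apply: (le_trans (le_normr_Rintegral _ iu')) => //.
apply: (@le_trans _ _ (\int[leb]_(t in `[0, x]) v t)).
  by apply: le_Rintegral => //; exact: integrable_norm.
rewrite -lee_fin /Rintegral !fineK ?integrable_fin_num//.
apply: ge0_subset_integral => //; last exact: sub0x.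
- by case/integrableP : iv.
- by move=> t _; rewrite lee_fin (le_trans _ (uv t)).
Qed.

End LpOperator.


Section BoundedOperator.
Variables (R : realType) (k : scalar_kind).
Implicit Types (u v w : R -> R) (g h : R -> scalar_field R k) (p : \bar R).
Local Notation leb := (@lebesgue_measure R).
Local Notation mR := (measurableTypeR R).
Local Notation I := (`[0, 1]%classic : set R).

Lemma kmeasurable_ktconv p g : (1 <= p)%E -> in_Lp p g -> kmeasurable_01 (ktconv g).
Proof.
move=> p1 gp; apply: measurable_kmk.
- apply: (@eq_measurable_fun _ _ mR mR I (tconv (fun t => kre (g t)))).
    by move=> x _; rewrite kre_ktconv.
  by apply: measurable_tconv; exact: integrable_kre gp.
- apply: (@eq_measurable_fun _ _ mR mR I (tconv (fun t => kim (g t)))).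
    by move=> x _; rewrite kim_ktconv.
  by apply: measurable_tconv; exact: integrable_kim gp.
Qed.

Definition modulus01 g : R -> R := (fun t => modulus (g t)) \_ I.

Lemma modulus_ktconv_le p g x : (1 <= p)%E -> in_Lp p g -> 0 <= x <= 1 ->
  modulus (ktconv g x) <= (modulus01 g x + modulus01 g x) +
    (\int[leb]_(t in I) modulus (g t) + \int[leb]_(t in I) modulus (g t)) +
    (modulus01 g (x - 2^-1) + modulus01 g (x - 2^-1)).
Proof.
move=> p1 gp x01; rewrite /modulus01.
set W := (fun t => _) \_ I; set c := \int[leb]_(t in I) _.
have Wx : W x = modulus (g x) by rewrite /W patchE mem_set//= in_itv.
have im := in_Lp_integrable p1 gp.
have B (q : scalar_field R k -> R) :
    (forall z, `|q z| <= modulus z) -> leb.-integrable I (EFin \o (fun t => q (g t))) ->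
    `|tconv (fun t => q (g t)) x| <= W x + c + W (x - 2^-1).
  move=> qm iq.
  have b1 : `|q (g x)| <= W x by rewrite Wx qm.
  have b2 : `|volterra (fun t => q (g t)) x| <= c.
    by apply: norm_volterra_integral_le => // t; exact: qm.
  have b3 : `|if 2^-1 <= x then q (g (x - 2^-1)) else 0| <= W (x - 2^-1).
    rewrite /W patchE mem_setE in_itv/= subr_ge0; case: (leP 2^-1 x) => xh /=.
      by rewrite ifT ?qm//; move: x01 (half01 R) => /andP[_]; lra.
    by rewrite normr0.
  rewrite /tconv /idVolterra; move: b3; set s := (if _ then _ else _) => b3.
  have := ler_normD (q (g x) - volterra (fun t => q (g t)) x) s.
  have := ler_normB (q (g x)) (volterra (fun t => q (g t)) x).
  by lra.
apply: (le_trans (modulus_le _)); rewrite kre_ktconv kim_ktconv.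
have b1 := B _ (@kre_le R k) (integrable_kre p1 gp).
have b2 := B _ (@kim_le R k) (integrable_kim p1 gp).
lra.
Qed.

Lemma Lp_norm_ktconv p g : (1 <= p)%E -> in_Lp p g ->
  (Lp_norm p (ktconv g) <= 6%:E * Lp_norm p g)%E.
Proof.
move=> p1 gp; have [mg g_lty] := gp.
pose W := modulus01 g.
pose c := \int[leb]_(t in I) modulus (g t).
pose C := (cst c : R -> R) \_ I.
pose S (x : mR) : R := W (x - 2^-1).
have mI : measurable (I : set mR) by exact: measurable_itv.
have mW : measurable_fun [set: mR] (W : mR -> R) by exact: measurable_modulus_restrict.
have mC : measurable_fun [set: mR] (C : mR -> R).
  by apply/(@measurable_restrictT _ _ mR R I (cst c) mI); exact: measurable_cst.
have mS : measurable_fun [set: mR] (S : mR -> R).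
  by apply: (measurableT_comp mW); exact: measurable_funB.
have W0 x : 0 <= W x by rewrite /W /modulus01 patchE; case: ifP => _ //; exact: modulus_ge0.
have c0 : 0 <= c by apply: Rintegral_ge0 => t _; exact: modulus_ge0.
have C0 x : 0 <= C x by rewrite /C patchE; case: ifP.
have nW : Lnorm leb p (EFin \o W) = Lp_norm p g by [].
have nC : (Lnorm leb p (EFin \o C) <= Lp_norm p g)%E.
  apply: (le_trans (Lnorm_cst01 p1 c0)).
  rewrite -(Rintegral_modulus (in_Lp_integrable p1 gp)).
  exact: Lp_norm1_le.
have nS : (Lnorm leb p (EFin \o S) <= Lp_norm p g)%E by exact: Lnorm_shift.
have N2 (f : mR -> R) : measurable_fun [set: mR] f ->
    (Lnorm leb p (EFin \o f) <= Lp_norm p g)%E ->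
    (Lnorm leb p (EFin \o (f \+ f)%R) <= Lp_norm p g + Lp_norm p g)%E.
  by move=> mf nf; apply: (le_trans (@eminkowski _ mR R leb f f p mf mf p1)); exact: leeD.
pose w := ((W \+ W) \+ (C \+ C) \+ (S \+ S))%R : mR -> R.
have mD (f f' : mR -> R) : measurable_fun [set: mR] f -> measurable_fun [set: mR] f' ->
    measurable_fun [set: mR] (f \+ f')%R.
  by move=> mf mf'; exact: measurable_funD.
apply: (@le_trans _ _ (Lnorm leb p (EFin \o w))).
  apply: le_Lnorm => //.
  - by apply: measurable_modulus_restrict; exact: kmeasurable_ktconv gp.
  - by apply: (mD); [apply: (mD); exact: (mD)|exact: (mD)].
  - move=> x; rewrite [leRHS]ger0_norm; last by rewrite /w /= !addr_ge0 ?W0 ?C0.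
    rewrite patchE; case: ifPn => xI; last first.
      by rewrite normr0 /w /= !addr_ge0 ?W0 ?C0.
    have x01 : 0 <= x <= 1 by move/set_mem : xI; rewrite /= in_itv.
    have Cx : C x = c by rewrite /C patchE xI.
    rewrite ger0_norm ?modulus_ge0//; have := modulus_ktconv_le p1 gp x01.
    by rewrite /w /= Cx.
apply: (le_trans (@eminkowski _ mR R leb ((W \+ W) \+ (C \+ C))%R (S \+ S)%R p _ _ p1)).
- by apply: (mD); exact: (mD).
- exact: (mD).
apply: (le_trans (leeD (@eminkowski _ mR R leb (W \+ W)%R (C \+ C)%R p _ _ p1) (N2 S mS nS))).
- exact: (mD).
- exact: (mD).
have := N2 _ mW (lexx _); have := N2 _ mC nC.
move=> h1 h2; apply: (le_trans (leeD (leeD h2 h1) (lexx _))).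
rewrite -(@fineK _ (Lp_norm p g)) ?ge0_fin_numE ?Lp_norm_ge0//.
by rewrite -!EFinD -EFinM lee_fin; lra.
Qed.

Lemma in_Lp_ktconv p g : (1 <= p)%E -> in_Lp p g -> in_Lp p (ktconv g).
Proof.
move=> p1 gp; split; first exact: kmeasurable_ktconv gp.
apply: (le_lt_trans (Lp_norm_ktconv p1 gp)).
have [_ g_lty] := gp.
rewrite -(@fineK _ (Lp_norm p g)) ?ge0_fin_numE ?Lp_norm_ge0//.
by rewrite -EFinM ltry.
Qed.

Lemma ktconv_lin p (a : scalar_field R k) g h x : (1 <= p)%E -> in_Lp p g -> in_Lp p h ->
  0 <= x <= 1 -> ktconv (fun t => a * g t + h t) x = a * ktconv g x + ktconv h x.
Proof.
move=> p1 gp hp x01; have ig := integrable_kre p1 gp; have ig' := integrable_kim p1 gp.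
have ih := integrable_kre p1 hp; have ih' := integrable_kim p1 hp.
apply: kscalarP.
- rewrite kre_lin !kre_ktconv kim_ktconv -tconv_lin//.
  by congr tconv; apply/funext => t; exact: kre_lin.
- rewrite kim_lin !kim_ktconv kre_ktconv -tconv_lin//.
  by congr tconv; apply/funext => t; exact: kim_lin.
Qed.

Lemma ae_eq_01W g h : (forall x, 0 <= x <= 1 -> g x = h x) -> ae_eq_01 g h.
Proof.
move=> gh; rewrite /ae_eq_01; apply: nearW => x /=; rewrite in_itv/=; exact: gh.
Qed.

Lemma ae_eq_01_trans g h (i : R -> scalar_field R k) :
  ae_eq_01 g h -> ae_eq_01 h i -> ae_eq_01 g i.
Proof.
have FF := ae_filter_ringOfSetsType leb.
by move=> gh hi; apply: (@filterS2 _ _ FF _ _ _ _ gh hi) => x e1 e2 xI; rewrite e1// e2.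
Qed.

Lemma bounded_ktconv p : (1 <= p)%E -> bounded_operator p (@ktconv R k).
Proof.
move=> p1; split.
- by move=> g; exact: in_Lp_ktconv.
- by move=> a g h gp hp; apply: ae_eq_01W => x; exact: (ktconv_lin a p1 gp hp).
- by exists 6 => g; exact: Lp_norm_ktconv.
Qed.

Lemma extends_ktconv : extends_convolution (conv_kmeasure R k) (@ktconv R k).
Proof.
by move=> g g0; apply: ae_eq_01W => x x01; rewrite truncated_convolutionE.
Qed.

Lemma convolution_on_Lp_ktconv p : (1 <= p)%E ->
  convolution_on_Lp (conv_kmeasure R k) p (@ktconv R k).
Proof.
move=> p1; split; first exact: bounded_ktconv.
case: eqP => _; last exact: extends_ktconv.
exists (@ktconv R k); split; [exact: bounded_ktconv|exact: extends_ktconv|].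
by move=> g _; exact: ae_eq_01W.
Qed.

Lemma bounded_operator_ae p T g h : (1 <= p)%E -> bounded_operator p T ->
  in_Lp p g -> in_Lp p h -> ae_eq_01 g h -> ae_eq_01 (T g) (T h).
Proof.
move=> p1 [Tstable Tlin [M TM]] gp hp gh.
have FF := ae_filter_ringOfSetsType leb.
pose d x := -1 * g x + h x.
have md : kmeasurable_01 d.
  apply: measurable_kmk.
  - apply: (@eq_measurable_fun _ _ mR mR I (fun x => kre (-1 : scalar_field R k) * kre (g x) +
      (- kim (-1 : scalar_field R k) * kim (g x) + kre (h x)))).
      by move=> x _; rewrite /d kre_lin.
    apply: measurable_funD.
      by apply: measurable_funM; [exact: measurable_cst|apply: measurable_kre; exact: gp.1].
    apply: measurable_funD; last by apply: measurable_kre; exact: hp.1.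
    by apply: measurable_funM; [exact: measurable_cst|apply: measurable_kim; exact: gp.1].
  - apply: (@eq_measurable_fun _ _ mR mR I (fun x => kre (-1 : scalar_field R k) * kim (g x) +
      (kim (-1 : scalar_field R k) * kre (g x) + kim (h x)))).
      by move=> x _; rewrite /d kim_lin.
    apply: measurable_funD.
      by apply: measurable_funM; [exact: measurable_cst|apply: measurable_kim; exact: gp.1].
    apply: measurable_funD; last by apply: measurable_kim; exact: hp.1.
    by apply: measurable_funM; [exact: measurable_cst|apply: measurable_kre; exact: gp.1].
have m0 : kmeasurable_01 (fun=> 0 : scalar_field R k).
  by apply: measurable_kmk; exact: measurable_cst.
have d0 : Lp_norm p d = 0%E.
  rewrite (ae_eq_Lp_norm p1 md m0).
    apply/eqP; rewrite eq_le Lp_norm_ge0 andbT; apply: Lp_norm_le_cst => //.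
    by move=> x _; rewrite modulus0.
  apply: (@filterS _ _ FF _ _ _ gh) => x gx xI.
  by rewrite /d gx// mulN1r addNr.
have dp : in_Lp p d by split => //; rewrite d0 ltry.
have [mTd _] := Tstable _ dp.
have : ae_eq_01 (T d) (fun=> 0).
  apply: (Lp_norm0_ae p1 mTd); apply/eqP; rewrite eq_le Lp_norm_ge0 andbT.
  by apply: (le_trans (TM _ dp)); rewrite d0 mule0.
have := Tlin (-1) _ _ gp hp => H1 H2.
apply: (@filterS2 _ _ FF _ _ _ _ H1 H2) => x e1 e2 xI.
have := e1 xI; rewrite e2// mulN1r addrC => /esym/eqP; rewrite subr_eq0.
by move=> /eqP.
Qed.

End BoundedOperator.


Section Limits.
Variable R : realType.
Implicit Types (a : (\bar R)^nat).

Lemma limn_einf_eq0 a : (forall n, 0 <= a n)%E ->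
  (forall (e : R) N, 0 < e -> exists2 n, (N <= n)%N & (a n <= e%:E)%E) ->
  limn_einf a = 0%E.
Proof.
move=> a0 ae; rewrite limn_einf_lim (_ : einfs a = fun=> 0%E); first exact: lim_cst.
apply/funext => N; apply/eqP; rewrite eq_le; apply/andP; split.
  apply/lee_addgt0Pr => e e0; rewrite add0e; have [n Nn an] := ae e N e0.
  by apply: le_trans an; apply: ereal_inf_lbound; exists n.
by apply: le_ereal_inf_tmp => _ [n _ <-].
Qed.

Lemma limn_esup_eqy a :
  (forall (A : R) N, exists2 n, (N <= n)%N & (A%:E <= a n)%E) ->
  limn_esup a = +oo%E.
Proof.
move=> aA; rewrite limn_esup_lim (_ : esups a = fun=> +oo%E); first exact: lim_cst.
apply/funext => N; apply/eqyP => A _.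
have [n Nn an] := aA A N; apply: le_trans an _.
by apply: ereal_sup_ubound; exists n.
Qed.

Lemma Lp_norm1_kmk k (u : R -> R) : causal u ->
  Lp_norm 1 (fun x => kmk k (u x) 0) = (volterra (fun x => `|u x|) 1)%:E.
Proof.
move=> cu; have cn := causal_norm cu.
have E : (fun x => modulus (kmk k (u x) 0)) = fun x => `|u x|.
  by apply/funext => x; rewrite modulus_mk0.
rewrite Rintegral_modulus; first by rewrite E.
by rewrite E; apply: continuous_integrable_itv; exact: cn.1.
Qed.

Lemma kmeasurable_kmk0 k (u : R -> R) : continuous u ->
  kmeasurable_01 (fun x => kmk k (u x) 0).
Proof.
move=> cu.
have mu : measurable_fun (`[0, 1]%classic : set (measurableTypeR R))
    (u : measurableTypeR R -> measurableTypeR R).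
  by apply: measurable_funTS; exact: continuous_measurable_fun.
by case: k => //=; split => //; exact: measurable_cst.
Qed.

Lemma in_Lp_kmk0 k p (u : R -> R) : (1 <= p)%E -> continuous u ->
  in_Lp p (fun x => kmk k (u x) 0).
Proof.
move=> p1 cu; split; first exact: kmeasurable_kmk0.
have [C CP] := continuous_bounded01 cu.
apply: (@le_lt_trans _ _ C%:E); last exact: ltry.
apply: Lp_norm_le_cst => //; first exact: kmeasurable_kmk0.
by move=> x x01; rewrite modulus_mk0 CP.
Qed.

Lemma eq_Lp_norm01 k p (g h : R -> scalar_field R k) :
  (forall x, 0 <= x <= 1 -> g x = h x) -> Lp_norm p g = Lp_norm p h.
Proof.
move=> gh; apply: eq_Lnorm => x /=; rewrite !patchE; case: ifPn => // /set_mem.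
by rewrite /= in_itv/= => /gh ->.
Qed.

Lemma ae_eq_iter k p (T : (R -> scalar_field R k) -> R -> scalar_field R k)
    (u : R -> R) n :
  (1 <= p)%E -> convolution_on_Lp (conv_kmeasure R k) p T -> causal u ->
  in_Lp p (iter n T (fun x => kmk k (u x) 0)) /\
  ae_eq_01 (iter n T (fun x => kmk k (u x) 0)) (fun x => kmk k (iter n tconv u x) 0).
Proof.
move=> p1 [bT eT] cu.
have cn m := causal_iter_tconv m cu.
have Lp m q : (1 <= q)%E -> in_Lp q (fun x => kmk k (iter m tconv u x) 0).
  by move=> q1; apply: in_Lp_kmk0 => //; exact: (cn m).1.
elim: n => [|n [IH1 IH2]]; first by split; [exact: (Lp 0%N)|exact: ae_eq_01W].
split; first by rewrite iterS; exact: (bounded_operator_stable bT).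
apply: ae_eq_01_trans (bounded_operator_ae p1 bT IH1 (Lp n p p1) IH2) _.
have step : ae_eq_01 (truncated_convolution (conv_kmeasure R k)
    (fun x => kmk k (iter n tconv u x) 0)) (fun x => kmk k (iter n.+1 tconv u x) 0).
  apply: ae_eq_01W => x x01.
  by rewrite -(iter_truncated_convolutionE k 1 (cn n) x01).
apply: ae_eq_01_trans step.
have g0 := C0_01_mk k (cn n).
move: eT; case: eqP => [pE [T1 [_ eT1 TT1]]|_ eT]; last exact: eT.
by apply: ae_eq_01_trans (eT1 _ g0); apply: TT1; rewrite -pE; exact: Lp.
Qed.

End Limits.

Theorem theorem1p5 (R : realType) (k : scalar_kind) :
  exists (mu : kmeasure R k) (f : R -> scalar_field R k),
    measure_01 mu /\ C0_01 f /\
    limn_einf (fun n : nat =>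
      Lp_norm +oo%E (iter n (truncated_convolution mu) f)) = 0%E /\
    limn_esup (fun n : nat =>
      Lp_norm 1%E (iter n (truncated_convolution mu) f)) = +oo%E /\
    forall p : \bar R, (1 <= p)%E ->
      (exists T, convolution_on_Lp mu p T) /\
      forall T, convolution_on_Lp mu p T -> irregular_Lp p T f.
Proof.
have [u [cu uinf usup]] := irregular_tconv R.
have cn n := causal_iter_tconv n cu.
pose f x := kmk k (u x) 0.
pose F n x := kmk k (iter n tconv u x) 0.
have mF n : kmeasurable_01 (F n) by apply: kmeasurable_kmk0; exact: (cn n).1.
have Finf p : (1 <= p)%E -> limn_einf (fun n => Lp_norm p (F n)) = 0%E.
  move=> p1; apply: limn_einf_eq0 => [n|e N e0]; first exact: Lp_norm_ge0.
  have [n Nn un] := uinf e N e0; exists n => //.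
  by apply: Lp_norm_le_cst => // x x01; rewrite modulus_mk0 un.
have Fsup p : (1 <= p)%E -> limn_esup (fun n => Lp_norm p (F n)) = +oo%E.
  move=> p1; apply: limn_esup_eqy => A N.
  have [n Nn un] := usup A N; exists n => //.
  apply: le_trans (Lp_norm1_le p1 (mF n)).
  by rewrite (Lp_norm1_kmk k (cn n)) lee_fin.
have E p : (fun n => Lp_norm p (iter n (truncated_convolution (conv_kmeasure R k)) f)) =
    (fun n => Lp_norm p (F n)).
  apply/funext => n; apply: eq_Lp_norm01 => x x01.
  exact: iter_truncated_convolutionE.
exists (conv_kmeasure R k), f; split; first exact: conv_kmeasure_01.
split; first exact: C0_01_mk.
split; first by rewrite E Finf// leey.
split; first by rewrite E Fsup.
move=> p p1; split; first by exists (@ktconv R k); exact: convolution_on_Lp_ktconv.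
move=> T pT; have E' : (fun n => Lp_norm p (iter n T f)) = (fun n => Lp_norm p (F n)).
  apply/funext => n; have [[mT _] TF] := ae_eq_iter n p1 pT cu.
  exact: ae_eq_Lp_norm.
split; last 2 first.
- by rewrite E' Finf.
- by rewrite E' Fsup.
- by apply: in_Lp_kmk0 => //; exact: cu.1.
Qed.
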